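(* Let $\Lambda>0$, $S_\Lambda:=1/(4\Lambda)$, and set $$v(x,t):=(1-4\Lambda t)^{-\frac N2}\exp\left(\frac{\Lambda H_0(x)^2}{1-4\Lambda t}\right).$$ Then $v$ is a solution of $\partial_t v=\Delta_H v$ in $\mathbf{R}^N\times[0,S_\Lambda)$ with initial data $v(\cdot,0)$, its initial data $\mu:=v(\cdot,0)\,dx$ satisfies $$\sup_{x\in\mathbf{R}^N}\int_{B_{H_0}(x,1/\sqrt{\Lambda})}e^{-\Lambda H_0(y)^2}\,d|\mu|(y)<\infty,$$ and $$\min_{x\in\mathbf{R}^N}v(x,t)=v(0,t)\to\infty\quad\text{as}\quad t\to S_\Lambda.$$
   Context: Let $N\ge 1$ and let $H\in C(\mathbf{R}^N)\cap C^1(\mathbf{R}^N\setminus\{0\})$ be a norm of $\mathbf{R}^N$: $H\ge 0$, $H(\xi)=0$ iff $\xi=0$, $H$ is convex, and $H(\alpha\xi)=|\alpha|H(\xi)$ for $\xi\in\mathbf{R}^N$, $\alpha\in\mathbf{R}$. The dual norm is $H_0(x):=\sup_{\xi\ne 0}\frac{x\cdot\xi}{H(\xi)}$, and $B_{H_0}(x,R):=\{y\in\mathbf{R}^N: H_0(y-x)<R\}$. Assume that the unit ball $\{\xi: H(\xi)<1\}$ is strictly convex (equivalently, $H_0\in C^1(\mathbf{R}^N\setminus\{0\})$). The Finsler-Laplace operator is $\Delta_H u:=\mathrm{div}\,(H(\nabla u)\nabla_\xi H(\nabla u))$, where $H(\xi)\nabla_\xi H(\xi)$ is taken to be $0$ at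 $\xi=0$. Definition of solution. Let $T>0$ and let $\mu$ be a (signed) Radon measure in $\mathbf{R}^N$. A measurable function $u$ in $\mathbf{R}^N\times(0,T)$ is a solution of $\partial_t u=\Delta_H u$ in $\mathbf{R}^N\times[0,T)$ with initial data $\mu$ if $u\in C((0,T):L^1(B_{H_0}(0,R)))\cap L^1((0,T-\epsilon):W^{1,1}(B_{H_0}(0,R)))$ for any $R>0$ and $0<\epsilon<T$, and $$\int_{\mathbf{R}^N}u(y,t)\varphi(y,t)\,dy+\int_0^t\int_{\mathbf{R}^N}\left[-u\,\partial_t\varphi+H(\nabla u)\nabla_\xi H(\nabla u)\cdot\nabla\varphi\right]dy\,ds=\int_{\mathbf{R}^N}\varphi(y,0)\,d\mu(y)$$ for all $0<t<T$ and $\varphi\in C_0^\infty(\mathbf{R}^N\times[0,T))$. A function $f$ as initial data is identified with the measure $f\,dx$. *)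

(* Defs.v *)
From HB Require Import structures.
From mathcomp Require Import all_boot all_order all_algebra.
From mathcomp Require Import all_classical all_reals all_analysis.
From mathcomp Require Import measurable_realfun.

Set Implicit Arguments.
Unset Strict Implicit.
Unset Printing Implicit Defensive.

Import Order.TTheory GRing.Theory Num.Theory.
Import numFieldNormedType.Exports.

Local Open Scope classical_set_scope.
Local Open Scope ring_scope.

Definition rV_display : measure_display -> measure_display.
Proof. exact. Qed.

(* The sigma-algebra of 'rV[T]_n is generated by the coordinate maps, as the
   library does for n.-tuple T; for T = R it is the Borel sigma-algebra. *)
Section measurable_rV.
Context {d} {T : measurableType d}.
Variable n : nat.

Definition rV_coord (i : 'I_n) (x : 'rV[T]_n) : T := x ord0 i.

Let rV_set0 : g_sigma_preimage rV_coord set0.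
Proof. exact: sigma_algebra0. Qed.

Let rV_setC A : g_sigma_preimage rV_coord A -> g_sigma_preimage rV_coord (~` A).
Proof. exact: sigma_algebraC. Qed.

Let rV_bigcup (F : (set 'rV[T]_n)^nat) :
  (forall i, g_sigma_preimage rV_coord (F i)) ->
  g_sigma_preimage rV_coord (\bigcup_i (F i)).
Proof. exact: sigma_algebra_bigcup. Qed.

HB.instance Definition _ := @isMeasurable.Build (rV_display d)
  'rV[T]_n (g_sigma_preimage rV_coord) rV_set0 rV_setC rV_bigcup.

End measurable_rV.

Lemma measurable_rV_coord d (T : measurableType d) n (i : 'I_n) :
  measurable_fun [set: 'rV[T]_n] (rV_coord i).
Proof.
move=> _ Y mY; rewrite setTI; apply: sub_sigma_algebra => /=.
rewrite -bigcup_seq/=; exists i => /=; first by rewrite mem_index_enum.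
by exists Y => //; rewrite setTI.
Qed.

Lemma measurable_fun_rVP d1 d2 (T1 : measurableType d1) (T2 : measurableType d2)
    n (f : T1 -> 'rV[T2]_n) :
  (forall i, measurable_fun [set: T1] (rV_coord i \o f)) ->
  measurable_fun [set: T1] f.
Proof.
move=> mf _ A mA; rewrite setTI.
suff : [set A | measurable (f @^-1` A)] A by [].
move: A mA; apply: smallest_sub.
  split => /=; first by rewrite preimage_set0.
  - by move=> A mA; rewrite setTD preimage_setC; exact: measurableC.
  - by move=> F mF; rewrite preimage_bigcup; exact: bigcupT_measurable.
move=> A; rewrite -bigcup_seq/= => -[i _ [Y mY <-]].
by rewrite setTI /= -comp_preimage -[_ @^-1` _]setTI; exact: mf.
Qed.

Section rV_cons.
Context {R : realType}.

Definition rV_cons n (p : R * 'rV[R]_n) : 'rV[R]_n.+1 :=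
  \row_(j < n.+1) oapp (fun i => p.2 ord0 i) p.1 (unlift ord0 j).

Lemma rV_cons_ord0 n (p : R * 'rV[R]_n) : rV_cons p ord0 ord0 = p.1.
Proof. by rewrite mxE unlift_none. Qed.

Lemma rV_cons_lift n (p : R * 'rV[R]_n) i :
  rV_cons p ord0 (lift ord0 i) = p.2 ord0 i.
Proof. by rewrite mxE liftK. Qed.

Lemma measurable_rV_cons n : measurable_fun setT (@rV_cons n).
Proof.
apply: measurable_fun_rVP => i; case: (unliftP ord0 i) => [j ->|->].
  rewrite (_ : _ \o _ = rV_coord j \o snd).
    apply: measurableT_comp; [exact: measurable_rV_coord|exact: measurable_snd].
  by apply/funext => p; rewrite /= /rV_coord rV_cons_lift.
rewrite (_ : _ \o _ = fst); first exact: measurable_fst.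
by apply/funext => p; rewrite /= /rV_coord rV_cons_ord0.
Qed.

Definition rV_uncons n (x : 'rV[R]_n.+1) : R * 'rV[R]_n :=
  (x ord0 ord0, \row_i x ord0 (lift ord0 i)).

Lemma rV_consK n : cancel (@rV_cons n) (@rV_uncons n).
Proof.
move=> [a x]; rewrite /rV_uncons rV_cons_ord0; congr pair.
by apply/rowP => i; rewrite mxE rV_cons_lift.
Qed.

Lemma rV_unconsK n : cancel (@rV_uncons n) (@rV_cons n).
Proof.
move=> x; apply/rowP => i; case: (unliftP ord0 i) => [j ->|->].
  by rewrite rV_cons_lift mxE.
by rewrite rV_cons_ord0.
Qed.

Lemma measurable_rV_uncons n : measurable_fun setT (@rV_uncons n).
Proof.
apply: measurable_fun_pair; first exact: (measurable_rV_coord ord0).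
apply: measurable_fun_rVP => i.
rewrite (_ : _ \o _ = rV_coord (lift ord0 i)); first exact: measurable_rV_coord.
by apply/funext => x; rewrite /= /rV_coord mxE.
Qed.

End rV_cons.

Section lebesgue_rVS.
Context {R : realType} (n : nat).
Variable m : {sigma_finite_measure set 'rV[R]_n -> \bar R}.

Definition lebesgue_rVS (A : set 'rV[R]_n.+1) : \bar R :=
  ((@lebesgue_measure R) \x m)%E (@rV_cons R n @^-1` A).

Let mpre A : measurable A -> measurable (@rV_cons R n @^-1` A).
Proof. by move=> mA; rewrite -[_ @^-1` _]setTI; exact: measurable_rV_cons. Qed.

Let lebesgue_rVS0 : lebesgue_rVS set0 = 0%E.
Proof. by rewrite /lebesgue_rVS preimage_set0 measure0. Qed.

Let lebesgue_rVS_ge0 A : (0 <= lebesgue_rVS A)%E.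
Proof. exact: measure_ge0. Qed.

Let lebesgue_rVS_sigma_additive : semi_sigma_additive lebesgue_rVS.
Proof.
move=> F mF tF mUF; rewrite /lebesgue_rVS preimage_bigcup.
apply: measure_semi_sigma_additive.
- by move=> k; exact: mpre.
- apply/trivIsetP => /= i j _ _ ij; rewrite -preimage_setI.
  by move/trivIsetP : tF => /(_ _ _ _ _ ij) ->//; rewrite preimage_set0.
- by rewrite -preimage_bigcup; exact: mpre.
Qed.

HB.instance Definition _ := isMeasure.Build _ _ _ lebesgue_rVS
  lebesgue_rVS0 lebesgue_rVS_ge0 lebesgue_rVS_sigma_additive.

Let lebesgue_rVS_sigma_finite : sigma_finite setT lebesgue_rVS.
Proof.
have /sigma_finiteP[F [TF ndF Foo]] := sigma_finiteT (@lebesgue_measure R).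
have /sigma_finiteP[G [TG ndG Goo]] := sigma_finiteT m.
exists (fun k => @rV_uncons R n @^-1` (F k `*` G k)).
  rewrite -preimage_bigcup (_ : \bigcup_k _ = setT) ?preimage_setT//.
  apply/seteqP; split => // -[x y] _.
  have [k _ Fkx] : (\bigcup_k F k) x by rewrite -TF.
  have [l _ Gly] : (\bigcup_k G k) y by rewrite -TG.
  exists (maxn k l) => //; split => /=.
    by move: x Fkx; exact/subsetPset/ndF/leq_maxl.
  by move: y Gly; exact/subsetPset/ndG/leq_maxr.
move=> k; have [mF Fk] := Foo k; have [mG Gk] := Goo k; split.
  by rewrite -[_ @^-1` _]setTI; apply: measurable_rV_uncons => //;
    exact: measurableX.
rewrite /lebesgue_rVS -comp_preimage (_ : _ \o _ = id); last first.
  by apply/funext => p /=; rewrite rV_consK.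
by rewrite preimage_id product_measure1E// lte_mul_pinfty// ge0_fin_numE.
Qed.

HB.instance Definition _ := @Measure_isSigmaFinite.Build _ _ _ lebesgue_rVS
  lebesgue_rVS_sigma_finite.

End lebesgue_rVS.

(* N-dimensional Lebesgue measure: a point mass in dimension 0, then the image
   of the product lebesgue_measure \x _ under R * 'rV_n ~ 'rV_n.+1. *)
Fixpoint lebesgue_rV (R : realType) (n : nat) :
    {sigma_finite_measure set 'rV[R]_n -> \bar R} :=
  match n with
  | 0 => dirac (0 : 'rV[R]_0)
  | m.+1 => lebesgue_rVS (lebesgue_rV R m)
  end.

Lemma measurable_rV_box (R : realType) n (B : 'I_n -> set R) :
  (forall i, measurable (B i)) ->
  measurable [set x : 'rV[R]_n | forall i, B i (x ord0 i)].
Proof.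
move=> mB; rewrite (_ : mkset _ = \bigcap_(i in [set: 'I_n]) rV_coord i @^-1` B i).
  apply: fin_bigcap_measurable => //.
  by move=> i _; rewrite -[_ @^-1` _]setTI; exact: measurable_rV_coord.
by apply/seteqP; split => x Bx i; [move=> _; exact: (Bx i)|exact: (Bx i I)].
Qed.

Lemma lebesgue_rV_box (R : realType) n (B : 'I_n -> set R) :
  (forall i, measurable (B i)) ->
  lebesgue_rV R n [set x | forall i, B i (x ord0 i)] =
  (\prod_(i < n) lebesgue_measure (B i))%E.
Proof.
elim: n B => [|n IH] B mB /=.
  by rewrite big_ord0 diracE mem_set//= => -[].
rewrite big_ord_recl -(IH (fun i => B (lift ord0 i)))//.
transitivity ((@lebesgue_measure R \x lebesgue_rV R n)%E
    (B ord0 `*` [set x : 'rV_n | forall i, B (lift ord0 i) (x ord0 i)])); last first.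
  by apply: product_measure1E; [exact: mB|exact: (measurable_rV_box (fun i => mB (lift ord0 i)))].
rewrite /lebesgue_rVS; congr (_ _); apply/seteqP; split => [[a x]|[a x]] /=.
  move=> Bx; split; first by have := Bx ord0; rewrite rV_cons_ord0.
  by move=> i; have := Bx (lift ord0 i); rewrite rV_cons_lift.
move=> [Ba Bx] i; case: (unliftP ord0 i) => [j ->|->].
  by rewrite rV_cons_lift; exact: Bx.
by rewrite rV_cons_ord0.
Qed.

Lemma ball_rVP (R : realType) n (x y : 'rV[R]_n) (e : R) : 0 < e ->
  ball x e y <-> forall i, ball (x ord0 i) e (y ord0 i).
Proof.
move=> e0; split => [[_ xy] i|xy]; first exact: xy.
by split => // i j; rewrite (ord1 i); exact: xy.
Qed.

Lemma open_measurable_rV (R : realType) n (U : set 'rV[R]_n) :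
  open U -> measurable U.
Proof.
move=> oU.
pose B (p : 'rV[rat]_n * nat) : set 'rV[R]_n :=
  ball (map_mx (ratr : rat -> R) p.1) (p.2.+1%:R^-1).
have k0 k : (0 : R) < k.+1%:R^-1 by rewrite invr_gt0.
have mB p : measurable (B p).
  rewrite (_ : B p = [set x : 'rV_n | forall i,
      ball ((map_mx (ratr : rat -> R) p.1) ord0 i) (p.2.+1%:R^-1) (x ord0 i)]).
    apply: (@measurable_rV_box _ _
      (fun i => ball ((map_mx (ratr : rat -> R) p.1) ord0 i)
        (p.2.+1%:R^-1))) => i.
    exact: measurable_ball.
  by apply/seteqP; split => x /ball_rVP; apply.
rewrite (_ : U = \bigcup_(p in [set p | B p `<=` U]) B p).
  rewrite bigcup_mkcond; apply: countable_bigcupT_measurable => // p.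
  by case: ifP => // _; exact: mB.
apply/seteqP; split => [x Ux|x [p /= BpU Bpx]]; last exact: BpU.
have /nbhs_ballP[e /= e0 xeU] : nbhs x U by exact: open_nbhs_nbhs.
have [k ke] : exists k : nat, k.+1%:R^-1 < e / 2.
  have /(@cvgrPdist_lt R R) /(_ (e / 2)) := @cvg_harmonic R.
  rewrite divr_gt0// => /(_ isT) [k _ /(_ k (leqnn k))].
  by rewrite /= sub0r normrN ger0_norm// => ?; exists k.
have /choice[q qP] : forall i : 'I_n, exists q : rat,
    `|x ord0 i - ratr q| < k.+1%:R^-1.
  move=> i; have /rat_in_itvoo[q] :
      x ord0 i - k.+1%:R^-1 < x ord0 i + k.+1%:R^-1.
    by rewrite ltrD2l gtrN.
  by rewrite in_itv/= => qx; exists q; rewrite distrC ltr_distl.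
exists (\row_i q i, k); last first.
  by apply/ball_rVP => // i; rewrite !mxE; apply: ball_sym; exact: qP.
move=> y /(ball_rVP _ _ (k0 k)) yB; apply: xeU; apply/ball_rVP => // i.
have := yB i; rewrite mxE mxE -!ball_normE/= => yqi.
rewrite (splitr e) -(subrKA (ratr (q i))) (le_lt_trans (ler_normD _ _))//.
by rewrite ltrD// (lt_trans _ ke).
Qed.

Lemma compact_measurable_rV (R : realType) n (K : set 'rV[R]_n) :
  compact K -> measurable K.
Proof.
move=> cK; rewrite -[K]setCK; apply: measurableC; apply: open_measurable_rV.
by rewrite openC; apply: compact_closed => //; exact: norm_hausdorff.
Qed.

Definition locally_integrable_rV (R : realType) n (f : 'rV[R]_n -> R) :=
  measurable_fun setT f /\ forall K, compact K ->
    (\int[lebesgue_rV R n]_(y in K) `|f y|%:E < +oo)%E.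

(* A signed Radon measure, given by its Jordan decomposition (so the total mass
   of either part may be infinite, which excludes the library's charges). *)
Record signed_radon (R : realType) (n : nat) := SignedRadon {
  radon_pos : {measure set 'rV[R]_n -> \bar R};
  radon_neg : {measure set 'rV[R]_n -> \bar R};
  radon_pos_fin : forall K, compact K -> (radon_pos K < +oo)%E;
  radon_neg_fin : forall K, compact K -> (radon_neg K < +oo)%E;
  radon_singular : exists P, [/\ measurable P, radon_pos (~` P) = 0%E &
    radon_neg P = 0%E] }.

Definition radon_variation (R : realType) n (mu : signed_radon R n) :
    {measure set 'rV[R]_n -> \bar R} :=
  measure_add (radon_pos mu) (radon_neg mu).

Definition radon_integral (R : realType) n (mu : signed_radon R n)
    (f : 'rV[R]_n -> R) : R :=
  \int[radon_pos mu]_y f y - \int[radon_neg mu]_y f y.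

(* The measure f^+ dx. *)
Definition pos_density (R : realType) n (f : 'rV[R]_n -> R)
    (mf : measurable_fun setT f) (A : set 'rV[R]_n) : \bar R :=
  (\int[lebesgue_rV R n]_(y in A) (Num.max (f y) 0)%:E)%E.

Section pos_density.
Context {R : realType} {n : nat}.
Variables (f : 'rV[R]_n -> R) (mf : measurable_fun setT f).
Local Notation nu := (pos_density mf).

Let nu0 : nu set0 = 0%E. Proof. exact: integral_set0. Qed.

Let nu_ge0 A : (0 <= nu A)%E.
Proof. by apply: integral_ge0 => y _; rewrite lee_fin le_max lexx orbT. Qed.

Let nu_sigma_additive : semi_sigma_additive nu.
Proof.
apply: semi_sigma_additive_nng_induced.
  by apply/measurable_EFinP; exact: measurable_maxr.
by move=> y; rewrite lee_fin le_max lexx orbT.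
Qed.

HB.instance Definition _ := isMeasure.Build _ _ _ nu nu0 nu_ge0
  nu_sigma_additive.

End pos_density.

Section radon_of_density.
Context {R : realType} {n : nat}.
Variables (f : 'rV[R]_n -> R) (lf : locally_integrable_rV f).

Let mf : measurable_fun setT f := lf.1.
Let mNf : measurable_fun setT (\- f) := measurable_funN lf.1.

Let density_fin (g : 'rV[R]_n -> R) (mg : measurable_fun setT g) :
  (forall y, `|g y| = `|f y|) ->
  forall K, compact K -> (pos_density mg K < +oo)%E.
Proof.
move=> gf K cK; apply: le_lt_trans (lf.2 _ cK).
have mK := compact_measurable_rV cK.
apply: ge0_le_integral => //.
- by move=> y _; rewrite lee_fin le_max lexx orbT.
- apply/measurable_EFinP/measurable_funTS.
  by apply: measurable_maxr => //; exact: measurable_cst.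
- by apply/measurable_EFinP/measurable_funTS; exact: measurableT_comp.
- by move=> y _; rewrite lee_fin -gf ge_max ler_norm normr_ge0.
Qed.

Let density_singular : exists P, [/\ measurable P,
  pos_density mf (~` P) = 0%E & pos_density mNf P = 0%E].
Proof.
exists (f @^-1` `[0, +oo[); split.
- by rewrite -[_ @^-1` _]setTI; exact: mf.
- apply: integral0_eq => y /=; rewrite in_itv/= andbT => /negP.
  by rewrite -ltNge => /ltW fy; rewrite (max_idPr fy).
- apply: integral0_eq => y /=; rewrite in_itv/= andbT => fy.
  by rewrite (@max_idPr _ _ (- f y) 0 _)// oppr_le0.
Qed.

(* The signed Radon measure f dx, with Jordan parts f^+ dx and f^- dx. *)
Definition radon_of_density : signed_radon R n :=
  @SignedRadon R n (pos_density mf) (pos_density mNf)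
    (density_fin mf (fun _ => erefl)) (density_fin mNf (fun y => normrN (f y)))
    density_singular.

End radon_of_density.

Section finsler.
Context {R : realType} {n : nat}.
Implicit Types (f H : 'rV[R]_n -> R) (x y xi : 'rV[R]_n).

Definition dotmul x y : R := \sum_(i < n) x ord0 i * y ord0 i.

Definition grad f x : 'rV[R]_n := \row_i 'D_(delta_mx ord0 i) (f : _ -> R^o) x.

(* For open A this is f \in C^1(A). *)
Definition C1_on (A : set 'rV[R]_n) f : Prop :=
  forall x, A x -> differentiable (f : _ -> R^o) x /\ {for x, continuous (grad f)}.

Definition strictly_convex_set (A : set 'rV[R]_n) : Prop :=
  forall x y, closure A x -> closure A y -> x != y ->
  forall t : R, 0 < t < 1 -> interior A (t *: x + (1 - t) *: y).

Record finsler_norm H : Prop := FinslerNorm {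
  finsler_continuous : continuous H;
  finsler_C1 : C1_on [set~ 0] H;
  finsler_ge0 : forall xi, 0 <= H xi;
  finsler_eq0 : forall xi, H xi = 0 <-> xi = 0;
  finsler_convex : @convex_function R 'rV[R]_n setT H;
  finsler_homogeneous : forall (a : R) xi, H (a *: xi) = `|a| * H xi }.

Definition dual_norm H x : R :=
  sup [set dotmul x xi / H xi | xi in [set xi | xi != 0]].

Definition dual_ball H x (r : R) : set 'rV[R]_n :=
  [set y | dual_norm H (y - x) < r].

(* H(xi) grad H(xi), extended by 0 at xi = 0 where H is not differentiable. *)
Definition finsler_flux H xi : 'rV[R]_n :=
  if xi == 0 then 0 else H xi *: grad H xi.

End finsler.

(* C^k functions on a finite-dimensional normed space, through iterated
   directional derivatives. *)
Fixpoint Ck (R : realType) (V : normedModType R) (k : nat) (f : V -> R^o) : Prop :=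
  match k with
  | 0 => continuous f
  | k'.+1 => (forall x, differentiable f x) /\
             (forall v, Ck k' (fun x => 'D_v f x))
  end.

Definition smooth (R : realType) (V : normedModType R) (f : V -> R^o) : Prop :=
  forall k, Ck k f.

Section sobolev.
Context {R : realType} {n : nat}.
Local Notation leb := (lebesgue_rV R n).
Implicit Types (D : set 'rV[R]_n) (f psi : 'rV[R]_n -> R)
  (g : 'rV[R]_n -> 'rV[R]_n).

Definition test_function D psi : Prop :=
  smooth psi /\ exists2 K, compact K /\ K `<=` D & forall x, ~ K x -> psi x = 0.

Definition L1 D f : Prop := leb.-integrable D (EFin \o f).

Definition weak_gradient D f g : Prop :=
  forall psi, test_function D psi -> forall i,
    \int[leb]_(y in D) (f y * grad psi y ord0 i) =
    - \int[leb]_(y in D) (g y ord0 i * psi y).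

(* f belongs to W^{1,1}(D) and g represents its weak gradient. Elements of the
   Sobolev space are handled as such pairs p = (f, g). *)
Definition W11 D : set (('rV[R]_n -> R) * ('rV[R]_n -> 'rV[R]_n)) :=
  [set p | [/\ L1 D p.1, forall i, L1 D (fun y => (p.2 y : 'rV_n) ord0 i) &
               weak_gradient D p.1 p.2]].

(* The Euclidean norm of the gradient is replaced by the equivalent l^1 norm. *)
Definition W11norm D (p : ('rV[R]_n -> R) * ('rV[R]_n -> 'rV[R]_n)) : \bar R :=
  (\int[leb]_(y in D) `|p.1 y|%:E +
   \sum_(i < n) \int[leb]_(y in D) `|(p.2 y : 'rV_n) ord0 i|%:E)%E.

End sobolev.

Section bochner.
Context {R : realType} {V : zmodType}.
Variables (I : set R) (X : set V) (nX : V -> \bar R).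

Definition simple_valued (s : R -> V) : Prop :=
  [/\ forall t, I t -> X (s t), finite_set (s @` I) &
      forall w, measurable (I `&` s @^-1` [set w])].

(* L^1(I : X) for a bounded I and a space X seminormed by nX: w is a.e. the limit
   of simple functions, and its norm is integrable. *)
Definition bochner_L1 (w : R -> V) : Prop :=
  [/\ {ae @lebesgue_measure R, forall t, I t -> X (w t)},
      exists s : nat -> R -> V, (forall k, simple_valued (s k)) /\
        {ae @lebesgue_measure R, forall t, I t ->
          nX (s k t - w t) @[k --> \oo] --> 0%E} &
      (\int[lebesgue_measure]_(t in I) nX (w t) < +oo)%E].

End bochner.

Section solution.
Context {R : realType} {n : nat}.
Local Notation leb := (lebesgue_rV R n).
Variable H : 'rV[R]_n -> R.

(* C_0^oo(R^N x [0,T[), as restrictions of functions smooth on R^N x R: the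
   support in R^N x [0,T[ is compact, but phi need not vanish at time 0. *)
Definition space_time_test (T : R) (phi : 'rV[R]_n * R -> R) : Prop :=
  smooth phi /\
  exists2 K : set ('rV[R]_n * R),
    compact K /\ K `<=` [set z | 0 <= z.2 < T] &
    forall z, 0 <= z.2 < T -> ~ K z -> phi z = 0.

Definition continuous_in_L1 (I : set R) (D : set 'rV[R]_n)
    (u : 'rV[R]_n -> R -> R) : Prop :=
  (forall t, I t -> L1 D (u ^~ t)) /\
  forall t, I t ->
    (\int[leb]_(y in D) `|u y s - u y t|%:E)%E @[s --> within I (nbhs t)] --> 0%E.

Definition weak_formulation (T : R) (mu : signed_radon R n)
    (u : 'rV[R]_n -> R -> R) (gu : 'rV[R]_n -> R -> 'rV[R]_n) : Prop :=
  forall t phi, 0 < t < T -> space_time_test T phi ->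
    \int[leb]_y (u y t * phi (y, t)) +
    \int[lebesgue_measure]_(s in `]0, t[) \int[leb]_y
      (- u y s * derive1 (fun r => phi (y, r) : R^o) s +
       dotmul (finsler_flux H (gu y s)) (grad (fun z => phi (z, s)) y)) =
    radon_integral mu (fun y => phi (y, 0)).

(* gu stands for the weak spatial gradient of u: it is determined by u up to
   null sets, so the existential is only a choice of representative. *)
Definition is_solution (T : R) (mu : signed_radon R n)
    (u : 'rV[R]_n -> R -> R) : Prop :=
  measurable_fun (setT `*` `]0, T[) (fun z : 'rV[R]_n * R => u z.1 z.2) /\
  exists gu : 'rV[R]_n -> R -> 'rV[R]_n,
    [/\ forall r, 0 < r -> continuous_in_L1 `]0, T[ (dual_ball H 0 r) u,
        forall r e, 0 < r -> 0 < e < T ->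
          bochner_L1 `]0, T - e[ (W11 (dual_ball H 0 r))
            (W11norm (dual_ball H 0 r)) (fun t => (u ^~ t, gu ^~ t)) &
        weak_formulation T mu u gu].

End solution.

(* Main.v *)
Require Import Defs.
From mathcomp Require Import all_boot all_order all_algebra.
From mathcomp Require Import all_classical all_reals all_analysis.
From mathcomp Require Import measurable_realfun ring lra.

Set Implicit Arguments.
Unset Strict Implicit.
Unset Printing Implicit Defensive.

Import Order.TTheory GRing.Theory Num.Theory.
Import numFieldNormedType.Exports.

Local Open Scope classical_set_scope.
Local Open Scope ring_scope.

(* With F = H^2/2 and G = H0^2/2 its convex conjugate, strict convexity of the unit
   ball makes G differentiable: its gradient is the Legendre map x |-> Gamma(x), the
   unique xi with x.xi = H0(x)^2 and H(xi) = H0(x), and the flux H grad H inverts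
   Gamma because xi |-> H0(x) H(xi) - x.xi is minimal at Gamma(x).  Hence, writing
   lam = 1 - 4 Lambda t, the gradient of v is (2 Lambda / lam) v Gamma(x) while its
   flux is (2 Lambda / lam) v x, whose divergence is the time derivative of v by
   Euler's identity x.Gamma(x) = H0(x)^2.  The weak formulation is then the integral
   over space-time of d/dt (v phi), after subtracting a compactly supported spatial
   divergence. *)

(** * The dual norm and the Legendre map *)

(** Differentiability of [H0] has to be earned from strict convexity: Gamma is single-valued,
    compactness then makes it continuous, and subgradient inequalities at two nearby points squeeze
    the difference quotient of [H0 ^+ 2]. This produces directional derivatives, and everything
    after it is built to use no more: the chain rule is applied along lines, and integration by
    parts runs one coordinate at a time. Two time boundaries shape the weak formulation. Estimates
    are made on closed intervals [0, t] with t < T, away from the blow-up. A test function is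
    constrained only at times in [0, T[, so its time derivative is known to vanish far out in space
    only at positive times. Its spatial support is bounded, hence all integrals reduce to a box of
    finite measure with bounded integrands, which is what Fubini requires. The weight exp(-Lambda
    H0^2) is the reciprocal of v at time 0, so the weighted mass of a ball is its volume. *)

Section row_vectors.
Context {R : realType} {n : nat}.
Implicit Types (x y z : 'rV[R]_n) (a : R).

Lemma norm_coord_le x i : `|x ord0 i| <= `|x|.
Proof.
rewrite [leRHS]mx_normrE.
exact: (le_bigmax _ (fun ij : 'I_1 * 'I_n => `|x ij.1 ij.2|) (ord0, i)).
Qed.

Lemma norm_le_coord x a : 0 <= a -> (forall i, `|x ord0 i| <= a) -> `|x| <= a.
Proof.
move=> a0 xa; rewrite [leLHS]mx_normrE; apply/bigmax_leP; split => // -[i j] _ /=.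
by rewrite (ord1 i).
Qed.

Lemma compact_closed_box a : compact [set x : 'rV[R]_n | `|x| <= a].
Proof.
apply: bounded_closed_compact.
  exists a; split; first exact: num_real.
  by move=> b ab x /= xa; exact: (le_trans xa (ltW ab)).
apply: (continuous_closedP (fun x : 'rV[R]_n => `|x|)).1 (@closed_le _ a).
exact: norm_continuous.
Qed.

Lemma dotmulC x y : dotmul x y = dotmul y x.
Proof. by apply: eq_bigr => i _; rewrite mulrC. Qed.

Lemma dotmulDl x y z : dotmul (x + y) z = dotmul x z + dotmul y z.
Proof.
by rewrite /dotmul -big_split; apply: eq_bigr => i _ /=; rewrite mxE mulrDl.
Qed.

Lemma dotmulZl a x y : dotmul (a *: x) y = a * dotmul x y.
Proof.
by rewrite /dotmul mulr_sumr; apply: eq_bigr => i _; rewrite mxE mulrA.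
Qed.

Lemma dotmulDr x y z : dotmul x (y + z) = dotmul x y + dotmul x z.
Proof. by rewrite !(dotmulC x) dotmulDl. Qed.

Lemma dotmulZr a x y : dotmul x (a *: y) = a * dotmul x y.
Proof. by rewrite !(dotmulC x) dotmulZl. Qed.

Lemma dotmul0l x : dotmul 0 x = 0.
Proof. by rewrite -(scale0r 0) dotmulZl mul0r. Qed.

Lemma dotmulNl x y : dotmul (- x) y = - dotmul x y.
Proof. by rewrite -scaleN1r dotmulZl mulN1r. Qed.

Lemma dotmul_delta x i : dotmul x (delta_mx ord0 i) = x ord0 i.
Proof.
rewrite /dotmul (bigD1 i)//= big1 ?addr0; first by rewrite mxE !eqxx mulr1.
by move=> j ji; rewrite mxE (negbTE ji) andbF mulr0.
Qed.

(** The norm of ['rV[R]_n] is the largest absolute coordinate, hence the factor [n]; a crude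
    constant is enough for comparing norms. *)
Lemma dotmul_le_norm x y : dotmul x y <= n%:R * (`|x| * `|y|).
Proof.
apply: (@le_trans _ _ (\sum_(i < n) (`|x| * `|y|))).
  apply: ler_sum => i _; apply: (le_trans (ler_norm _)); rewrite normrM.
  by apply: ler_pM => //; exact: norm_coord_le.
by rewrite big_const_ord iter_addr addr0 mulr_natl.
Qed.

Lemma sqr_norm_le_dotmul x : `|x| ^+ 2 <= dotmul x x.
Proof.
have xx0 : 0 <= dotmul x x by apply: sumr_ge0 => i _; rewrite -expr2 sqr_ge0.
rewrite -(sqr_sqrtr xx0) ler_pXn2r ?nnegrE ?sqrtr_ge0//.
apply: norm_le_coord; rewrite ?sqrtr_ge0// => i.
rewrite -(ger0_norm (sqrtr_ge0 _)) -ler_sqr ?nnegrE// -normrX -normrX.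
rewrite sqr_sqrtr// !ger0_norm ?sqr_ge0// /dotmul (bigD1 i)//= -expr2.
by rewrite lerDl sumr_ge0// => j _; rewrite -expr2 sqr_ge0.
Qed.

Lemma cvg_dotmul {T : Type} {F : set_system T} {FF : Filter F}
    (f g : T -> 'rV[R]_n) x y :
  f @ F --> x -> g @ F --> y -> dotmul (f t) (g t) @[t --> F] --> dotmul x y.
Proof.
move=> fx gy; rewrite /dotmul; apply: cvg_big => [|i _].
  by move=> p; exact: add_continuous.
apply: cvgM.
  exact: (cvg_comp _ _ fx (@coord_continuous R 1 n ord0 i x)).
exact: (cvg_comp _ _ gy (@coord_continuous R 1 n ord0 i y)).
Qed.

End row_vectors.

(** * Directional derivatives as limits of difference quotients *)

Section directional_derivatives.
Context {R : realType} {V : normedModType R}.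
Implicit Types (f : V -> R^o) (a v : V).

Lemma cvg_is_derive f a v (d : R) :
  h^-1 * (f (h *: v + a) - f a) @[h --> (0 : R)^'] --> d -> is_derive a v f d.
Proof.
move=> fd; have fd' : (fun h => h^-1 *: ((f \o shift a) (h *: v) - f a)) @ 0^' --> d.
  exact: fd.
by apply: DeriveDef; [apply/cvg_ex; exists d|exact: cvg_lim].
Qed.

Lemma is_derive_cvg f a v (d : R) : is_derive a v f d ->
  h^-1 * (f (h *: v + a) - f a) @[h --> (0 : R)^'] --> d.
Proof. by move=> [/cvg_ex[l fl] <-]; rewrite /derive (cvg_lim _ fl). Qed.

(** Difference quotients are at least [d] for h > 0 and at most [d] for h < 0, and the derivative is
    the limit from both sides. This identifies the gradient of [H] without computing it. *)
Lemma derive_subgradient f a v (d : R) : derivable f a v ->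
  (forall h : R, f a + h * d <= f (h *: v + a)) -> 'D_v f a = d.
Proof.
move=> fav sub; have fd := is_derive_cvg (DeriveDef fav erefl).
have fdl : h^-1 * (f (h *: v + a) - f a) @[h --> (0 : R)^'-] --> 'D_v f a.
  apply: cvg_trans fd; apply: cvg_app => A [e e0 Ae].
  by exists e => // x xe x0; apply: Ae => //; exact: ltr0_neq0.
have fdr : h^-1 * (f (h *: v + a) - f a) @[h --> (0 : R)^'+] --> 'D_v f a.
  apply: cvg_trans fd; apply: cvg_app => A [e e0 Ae].
  by exists e => // x xe x0; apply: Ae => //; exact: lt0r_neq0.
apply/eqP; rewrite eq_le; apply/andP; split.
  apply: (cvgr_to_le fdl); exists 1 => //= h _ h0.
  by rewrite -(ler_nM2l h0) mulrA divff ?lt_eqF// mul1r lerBrDl sub.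
apply: (cvgr_to_ge fdr); exists 1 => //= h _ h0.
by rewrite -(ler_pM2l h0) mulrA divff ?gt_eqF// mul1r lerBrDl sub.
Qed.

End directional_derivatives.

(** * Duality between [H] and [H0] *)

Section finsler_duality.
Context {R : realType} {n : nat}.
Variable H : 'rV[R]_n -> R.
Hypotheses (n_gt0 : (0 < n)%N) (normH : finsler_norm H).
Hypothesis sconvH : strictly_convex_set [set xi | H xi < 1].
Local Notation H0 := (dual_norm H).
Implicit Types x y xi : 'rV[R]_n.

Let sphere := [set xi : 'rV[R]_n | `|xi| = 1].

Let compact_sphere : compact sphere.
Proof.
apply: (@subclosed_compact _ _ [set x : 'rV[R]_n | `|x| <= 1]).
- apply: (continuous_closedP (fun x : 'rV[R]_n => `|x|)).1 (@closed_eq _ 1).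
  exact: norm_continuous.
- exact: compact_closed_box.
- by move=> x /= ->.
Qed.

Let sphere_neq0 : sphere !=set0.
Proof.
pose d : 'rV[R]_n := delta_mx ord0 (Ordinal n_gt0).
exists (`|d|^-1 *: d); rewrite /sphere /= normrZ normfV normr_id mulVf// normr_eq0.
apply/eqP => /rowP/(_ (Ordinal n_gt0)).
by rewrite !mxE !eqxx => /eqP; rewrite oner_eq0.
Qed.

Let normalize xi : xi != 0 -> sphere (`|xi|^-1 *: xi).
Proof. by move=> xi0; rewrite /sphere/= normrZ normfV normr_id mulVf// normr_eq0. Qed.

Lemma finsler_gt0 xi : xi != 0 -> 0 < H xi.
Proof.
move=> xi0; rewrite lt_neqAle (finsler_ge0 normH) andbT eq_sym.
by apply: contra_neq xi0 => /(finsler_eq0 normH).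
Qed.

Lemma finsler0 : H 0 = 0. Proof. exact/(finsler_eq0 normH). Qed.

Let sphere_nz xi : sphere xi -> xi != 0.
Proof.
by move=> xi1; rewrite -normr_eq0 xi1 oner_neq0.
Qed.

(** By homogeneity the minimum of [H] on the compact unit sphere serves as constant; it is positive
    because it is attained at a nonzero vector. *)
Lemma finsler_ge_norm : exists2 c : R, 0 < c & forall xi, c * `|xi| <= H xi.
Proof.
have [c /set_mem cS cmin] : exists2 c, c \in sphere & forall t, t \in sphere -> H c <= H t.
  apply: EVT_min_rV => //; apply: continuous_subspaceT.
  exact: (finsler_continuous normH).
exists (H c) => [|xi]; first exact/finsler_gt0/sphere_nz.
have [->|xi0] := eqVneq xi 0; first by rewrite normr0 mulr0 finsler0.
rewrite -ler_pdivlMr ?normr_gt0//; have := cmin _ (mem_set (normalize xi0)).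
by rewrite (finsler_homogeneous normH) ger0_norm ?invr_ge0// mulrC.
Qed.

Lemma finsler_le_norm : exists2 C : R, 0 < C & forall xi, H xi <= C * `|xi|.
Proof.
have [c /set_mem cS cmax] : exists2 c, c \in sphere & forall t, t \in sphere -> H t <= H c.
  apply: EVT_max_rV => //; apply: continuous_subspaceT.
  exact: (finsler_continuous normH).
exists (H c) => [|xi]; first exact/finsler_gt0/sphere_nz.
have [->|xi0] := eqVneq xi 0; first by rewrite normr0 mulr0 finsler0.
rewrite -ler_pdivrMr ?normr_gt0//; have := cmax _ (mem_set (normalize xi0)).
by rewrite (finsler_homogeneous normH) ger0_norm ?invr_ge0// mulrC.
Qed.

(** The quotient x.xi / H(xi) is invariant under positive scaling, so its supremum is a maximum over
    the compact unit sphere; rescaling a maximizer meets both equations at once. *)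
Let duality x : exists xi, [/\ dotmul x xi = H0 x ^+ 2, H xi = H0 x &
  forall eta, dotmul x eta <= H0 x * H eta].
Proof.
have [c /set_mem cS cmax] : exists2 c, c \in sphere & forall t, t \in sphere ->
    dotmul x t / H t <= dotmul x c / H c.
  apply: EVT_max_rV => //; apply: continuous_in_subspaceT => y /set_mem /sphere_nz y0.
  (* The filter instance of a neighbourhood in ['rV[R]_n] is found only when it is in
     the context: its matrix and normed topologies agree only up to conversion. *)
  have FF : Filter (nbhs y) := nbhs_filter y.
  apply: cvgM; first by apply: cvg_dotmul; [exact: cvg_cst|exact: cvg_id].
  by apply: cvgV; [rewrite gt_eqF// finsler_gt0|exact: (finsler_continuous normH)].
have c0 := sphere_nz cS; have Hc := finsler_gt0 c0.
pose M := dotmul x c / H c.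
have ubM xi : xi != 0 -> dotmul x xi / H xi <= M.
  move=> xi0; have := cmax _ (mem_set (normalize xi0)).
  rewrite (finsler_homogeneous normH) dotmulZr normfV normr_id -mulf_div.
  by rewrite divff ?mul1r// invr_eq0 normr_eq0.
have HM : H0 x = M.
  apply/eqP; rewrite eq_le; apply/andP; split.
    apply: ge_sup; first by exists M; exists c.
    by move=> _ /= [xi xi0 <-]; exact: ubM.
  apply: ub_le_sup; last by exists c.
  by exists M => _ /= [xi xi0 <-]; exact: ubM.
(* A vector and its opposite have opposite quotients, so the maximum is nonnegative. *)
have M0 : 0 <= M.
  have := ubM (- c); rewrite oppr_eq0 => /(_ c0).
  rewrite -scaleN1r (finsler_homogeneous normH) dotmulZr normrN normr1 mul1r mulN1r mulNr -/M.
  lra.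
(* The multiple of [c] on which [H] equals [M]; its pairing with x is then M^2. *)
exists ((M / H c) *: c); split.
- by rewrite dotmulZr HM expr2 -mulrA; congr (_ * _); rewrite /M mulrC.
- by rewrite (finsler_homogeneous normH) HM ger0_norm ?divfK ?gt_eqF// divr_ge0// ltW.
- move=> xi; have [->|xi0] := eqVneq xi 0.
    by rewrite finsler0 mulr0 dotmulC dotmul0l.
  by rewrite HM -ler_pdivrMr ?finsler_gt0// ubM.
Qed.

(* The Legendre map, i.e. the gradient of [H0 ^+ 2 / 2], inverse to the flux. *)
Definition legendre x : 'rV[R]_n :=
  xget 0 [set xi | dotmul x xi = H0 x ^+ 2 /\ H xi = H0 x].

Let legendreP x : dotmul x (legendre x) = H0 x ^+ 2 /\ H (legendre x) = H0 x.
Proof.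
by have [xi [xxi Hxi _]] := duality x; rewrite /legendre; case: xgetP => [y _ //|/(_ xi)[]].
Qed.

Lemma dotmul_legendre x : dotmul x (legendre x) = H0 x ^+ 2.
Proof. by have [] := legendreP x. Qed.

Lemma finsler_legendre x : H (legendre x) = H0 x.
Proof. by have [] := legendreP x. Qed.

Lemma dotmul_le_dual x xi : dotmul x xi <= H0 x * H xi.
Proof. by have [_ [_ _]] := duality x; exact. Qed.

Lemma dual_norm_ge0 x : 0 <= H0 x.
Proof. by rewrite -finsler_legendre finsler_ge0. Qed.

Lemma dual_norm0 : H0 0 = 0.
Proof.
by apply/eqP; rewrite -sqrf_eq0 -dotmul_legendre dotmul0l.
Qed.

(** Pairing [x] with itself: |x|^2 <= x.x <= H0(x) H(x) <= C H0(x) |x|. *)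
Lemma norm_le_dual : exists2 C : R, 0 < C & forall x, `|x| <= C * H0 x.
Proof.
have [C C0 HC] := finsler_le_norm; exists C => // x.
have [->|x0] := eqVneq x 0; first by rewrite normr0 dual_norm0 mulr0.
have x0' : 0 < `|x| by rewrite normr_gt0.
rewrite -(ler_pM2l x0') -expr2 (le_trans (sqr_norm_le_dotmul x))//.
apply: (le_trans (dotmul_le_dual x x)).
by rewrite mulrA [leRHS]mulrC ler_wpM2l ?dual_norm_ge0// mulrC HC.
Qed.

(** Pairing [x] with [legendre x], whose norm is at most H0(x) / c, bounds H0(x)^2 by n |x| H0(x) /
    c. *)
Lemma dual_le_norm : exists2 C : R, 0 < C & forall x, H0 x <= C * `|x|.
Proof.
have [c c0 Hc] := finsler_ge_norm; exists (n%:R / c); first by rewrite divr_gt0// ltr0n.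
move=> x; have [->|x0] := eqVneq (H0 x) 0; first by rewrite mulr_ge0// divr_ge0// ltW.
have {}x0 : 0 < H0 x by rewrite lt_neqAle eq_sym x0 dual_norm_ge0.
rewrite -(ler_pM2r x0) -expr2 -dotmul_legendre (le_trans (dotmul_le_norm _ _))//.
rewrite (_ : _ / c * _ * _ = n%:R * (`|x| * (c^-1 * H0 x))); last by ring.
rewrite ler_wpM2l ?ler0n// ler_wpM2l// -(ler_pM2l c0) mulrA divff ?gt_eqF//.
by rewrite mul1r -finsler_legendre Hc.
Qed.

(** Both summands are paired with the same vector [legendre (x + y)], on which [H] equals H0(x + y);
    dividing by that number concludes. *)
Lemma dual_normD x y : H0 (x + y) <= H0 x + H0 y.
Proof.
have [h0|h0] := eqVneq (H0 (x + y)) 0; first by rewrite h0 addr_ge0 ?dual_norm_ge0.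
have {}h0 : 0 < H0 (x + y) by rewrite lt_neqAle eq_sym h0 dual_norm_ge0.
rewrite -(ler_pM2r h0) -expr2 -dotmul_legendre dotmulDl mulrDl.
by rewrite -(finsler_legendre (x + y)) lerD// dotmul_le_dual.
Qed.

Lemma dual_norm_continuous : continuous H0.
Proof.
have [C C0 HC] := dual_le_norm => x; have FF : Filter (nbhs x) := nbhs_filter x.
apply/(@cvgrPdist_le _ _ _ (nbhs (x : 'rV[R]_n))) => /= e e0.
have : \forall y \near x, `|x - y| < e / C.
  apply: (@cvgr_dist_lt _ _ _ (nbhs x) _ id (x : 'rV[R]_n)); first exact: cvg_id.
  by rewrite divr_gt0.
apply: filterS => y /ltW xy; rewrite ler_pdivlMr// mulrC in xy.
have lip u w : H0 u - H0 w <= C * `|u - w|.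
  rewrite lerBlDr (le_trans _ (lerD (HC _) (lexx _)))//.
  by rewrite -{1}(subrK w u) dual_normD.
rewrite ler_norml lerNl opprB (le_trans (lip _ _))/=; last by rewrite distrC.
exact: le_trans (lip _ _) xy.
Qed.

(** [strictly_convex_set] speaks of closure points, so unit vectors are exhibited as limits of the
    points (1 - 1/(k+1)) xi of the open ball. *)
Let closure_ball xi : H xi = 1 -> closure [set xi | H xi < 1] xi.
Proof.
move=> Hxi B; have : (1 - k.+1%:R^-1) *: xi @[k --> \oo] --> xi.
  rewrite -[X in _ --> X]scale1r; apply: cvgZr_tmp.
  rewrite -[X in _ --> X]subr0; apply: cvgB; first exact: cvg_cst.
  exact: cvg_harmonic.
move=> /[apply] -[k _ /(_ k (leqnn k))] /= Bk.
exists ((1 - k.+1%:R^-1) *: xi); split => //=.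
rewrite (finsler_homogeneous normH) Hxi mulr1 ger0_norm; last first.
  by rewrite subr_ge0 invf_le1 ?ltr0n// ler1n.
by rewrite ltrBlDr ltrDl invr_gt0 ltr0n.
Qed.

(** Two distinct solutions, normalised to [H] = 1, have their midpoint [m] in the open unit ball,
    while x.m = H0(x); this contradicts x.m <= H0(x) H(m) < H0(x). Strict convexity enters the proof
    here. *)
Lemma legendre_unique x xi : dotmul x xi = H0 x ^+ 2 -> H xi = H0 x -> xi = legendre x.
Proof.
move=> xxi Hxi; have [h0|h0] := eqVneq (H0 x) 0.
  have := finsler_legendre x; rewrite h0 => /(finsler_eq0 normH) ->.
  by move: Hxi; rewrite h0 => /(finsler_eq0 normH).
have {}h0 : 0 < H0 x by rewrite lt_neqAle eq_sym h0 dual_norm_ge0.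
apply/eqP; rewrite -subr_eq0 -(inj_eq (@scalerI _ _ (H0 x)^-1 _)) ?invr_eq0 ?gt_eqF//.
rewrite scaler0 scalerBr subr_eq0; apply: contraT => neq.
have nrm eta : H eta = H0 x -> H ((H0 x)^-1 *: eta) = 1.
  by move=> He; rewrite (finsler_homogeneous normH) He ger0_norm ?invr_ge0 ?ltW// mulVf// gt_eqF.
have h12 : 0 < (2^-1 : R) < 1 by apply/andP; split; lra.
have := sconvH (closure_ball (nrm _ Hxi)) (closure_ball (nrm _ (finsler_legendre x))) neq h12.
move=> /nbhs_singleton /=; set m := (X in H X).
have xm : dotmul x m = H0 x.
  rewrite dotmulDr !dotmulZr xxi dotmul_legendre; field.
  by rewrite gt_eqF.
have := dotmul_le_dual x m; rewrite xm -{1}(mulr1 (H0 x)) ler_pM2l//.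
by move=> /le_lt_trans/[apply]; rewrite ltxx.
Qed.

(** Uniqueness plus compactness: on the compact set [K] of candidates at distance at least [e] from
    [legendre x] the equations for x fail, so those for y fail on all of [K] once y is close to x.
    Since [legendre y] stays bounded, it can only lie within [e] of [legendre x]. *)
Lemma legendre_continuous : continuous legendre.
Proof.
move=> x; have FF : Filter (nbhs x) := nbhs_filter x.
apply/(@cvgrPdist_lt _ _ _ (nbhs (x : 'rV[R]_n))) => /= e e0.
have [c c0 Hc] := finsler_ge_norm.
(* Bounds the norm of [legendre y] as soon as H0(y) < H0(x) + 1. *)
pose M := (H0 x + 1) / c.
pose K := [set xi : 'rV[R]_n | `|xi| <= M] `&` [set xi | e <= `|legendre x - xi|].
have cK : compact K.
  apply: compact_closedI; first exact: compact_closed_box.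
  apply: (continuous_closedP (fun xi => `|legendre x - xi|)).1 (@closed_ge _ e) => xi.
  have FFxi : Filter (nbhs xi) := nbhs_filter xi.
  by apply: cvg_norm; apply: cvgB; [exact: cvg_cst|exact: cvg_id].
have nK : \forall y \near (x : 'rV[R]_n), K `<=`
    (fun xi => ~ (dotmul y xi = H0 y ^+ 2 /\ H xi = H0 y)).
  apply: ((compact_near_coveringP K).1 cK _ (nbhs x)
    (fun y xi => ~ (dotmul y xi = H0 y ^+ 2 /\ H xi = H0 y)) FF) => xi [/= _ exi].
  (* The joint defect of the two equations: continuous, and zero exactly at solutions, hence
     positive around (xi, x). *)
  pose f (p : 'rV[R]_n * 'rV[R]_n) : R :=
    `|dotmul p.2 p.1 - H0 p.2 ^+ 2| + `|H p.1 - H0 p.2|.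
  have FFxi : Filter (nbhs xi) := nbhs_filter xi.
  have c1 : H0 p.2 @[p --> filter_prod (nbhs xi) (nbhs x)] --> H0 x.
    apply: (@cvg_comp _ _ _ snd H0 _ (nbhs x)); last exact: dual_norm_continuous.
    exact: cvg_snd.
  have fcont : f p @[p --> filter_prod (nbhs xi) (nbhs x)] --> f (xi, x).
    apply: cvgD; apply: cvg_norm; apply: cvgB => //.
    + by apply: cvg_dotmul; [exact: cvg_snd|exact: cvg_fst].
    + exact: cvgM.
    + apply: (@cvg_comp _ _ _ fst H _ (nbhs xi)); first exact: cvg_fst.
      exact: (finsler_continuous normH).
  have fgt0 : 0 < f (xi, x).
    rewrite lt_neqAle addr_ge0// andbT eq_sym; apply/negP.
    rewrite /f paddr_eq0//= !normr_eq0 !subr_eq0 => /andP[/eqP xxi /eqP Hxi].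
    by move: exi; rewrite -(legendre_unique xxi Hxi) subrr normr0 leNgt e0.
  have FFp : Filter (filter_prod (nbhs xi) (nbhs x)) := filter_prod_filter _ _.
  apply: filterS (cvgr_gt _ fcont _ fgt0) => -[xi' y] /=; rewrite /f /= => + [e1 e2].
  rewrite e1 e2.
  by rewrite !subrr normr0 addr0 ltxx.
have nH : \forall y \near (x : 'rV[R]_n), H0 y < H0 x + 1.
  by apply: (cvgr_lt _ (@dual_norm_continuous x)); rewrite ltrDl.
apply: filterS2 nK nH => y nK nH.
rewrite ltNge; apply/negP => ey.
suff /nK : K (legendre y) by apply; exact: legendreP.
split => //=; rewrite /M ler_pdivlMr// mulrC (le_trans (Hc _))// finsler_legendre.
exact: ltW.
Qed.

(** The vector 2 [legendre w] is a subgradient of H0^2 at every w. Used at x and at x + hv, this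
    traps the increment between h d and h b, where b is the analogue of d at the moved point and
    tends to d by continuity of [legendre]. *)
Lemma is_derive_sqr_dual x v :
  is_derive x v (fun y => H0 y ^+ 2 : R^o) (2 * dotmul v (legendre x)).
Proof.
apply: cvg_is_derive; set d := 2 * _.
(* From y.legendre(w) <= H0(y) H0(w) and 2ab <= a^2 + b^2. *)
have grow y w : H0 w ^+ 2 + 2 * dotmul (y - w) (legendre w) <= H0 y ^+ 2.
  rewrite dotmulDl dotmulNl dotmul_legendre.
  have := dotmul_le_dual y (legendre w); rewrite finsler_legendre => yw.
  have := sqr_ge0 (H0 y - H0 w); nra.
have dh (h : R) : h != 0 -> `|d - h^-1 * (H0 (h *: v + x) ^+ 2 - H0 x ^+ 2)| <=
    `|d - 2 * dotmul v (legendre (h *: v + x))|.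
  move=> h0; set y := h *: v + x; set b := 2 * _.
  have hdb : h * d <= H0 y ^+ 2 - H0 x ^+ 2 <= h * b.
    have := grow y x; have := grow x y.
    rewrite -(opprB y x) {1 3}/y addrK dotmulNl !dotmulZl /d /b; lra.
  move: hdb; set D := _ - _ => /andP[hd hb].
  rewrite -(ler_pM2l (_ : 0 < `|h|)) ?normr_gt0// -!normrM mulrBr mulVKf//.
  by rewrite mulrBr !ler0_norm ?subr_le0//; lra.
apply/cvgrPdist_le => e e0.
have FF : Filter (0 : R)^' by exact: within_filter.
have : 2 * dotmul v (legendre (h *: v + x)) @[h --> (0 : R)^'] --> d.
  apply: cvgM; first exact: cvg_cst.
  apply: cvg_dotmul; first exact: cvg_cst.
  apply: (@cvg_comp _ _ _ (fun h => h *: v + x) legendre _ (nbhs x)).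
    apply: cvg_within_filter.
    have : h *: v + x @[h --> (0 : R)] --> 0 *: v + x.
      by apply: cvgD; [exact: cvgZr_tmp|exact: cvg_cst].
    by rewrite scale0r add0r.
  exact: legendre_continuous.
move=> /cvgrPdist_le /(_ e e0); apply: filterS2 (nbhs_dnbhs_neq _) => h h0.
exact/le_trans/dh.
Qed.

(** The vector x / H0(x) is a subgradient of [H] at c Gamma(x), hence the gradient there;
    multiplying by H = c H0(x) gives c x. At x = 0 the flux takes its conventional value 0. *)
Lemma finsler_flux_legendre (c : R) x : 0 < c ->
  finsler_flux H (c *: legendre x) = c *: x.
Proof.
move=> c0; have [->|x0] := eqVneq x 0.
  have -> : legendre 0 = 0.
    by apply/(finsler_eq0 normH); rewrite finsler_legendre dual_norm0.
  by rewrite !scaler0 /finsler_flux eqxx.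
have h0 : 0 < H0 x.
  rewrite lt_neqAle dual_norm_ge0 andbT eq_sym; apply: contra_neq x0 => h0.
  have [C C0 /(_ x)] := norm_le_dual; rewrite h0 mulr0 normr_le0.
  by move/eqP.
have g0 : c *: legendre x != 0.
  rewrite scaler_eq0 gt_eqF//=; apply/eqP => g0.
  by move: h0; rewrite -finsler_legendre g0 finsler0 ltxx.
rewrite /finsler_flux (negbTE g0) (finsler_homogeneous normH) finsler_legendre.
rewrite gtr0_norm// -scalerA; congr (_ *: _); apply/rowP => i; rewrite !mxE.
have [dH _] := finsler_C1 normH (elimN eqP g0).
rewrite (@derive_subgradient _ _ _ _ _ (x ord0 i / H0 x)).
- by rewrite mulrC divfK// gt_eqF.
- exact: diff_derivable.
- move=> h; rewrite -(ler_pM2l h0).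
  apply: le_trans (dotmul_le_dual _ _).
  rewrite dotmulDr !dotmulZr dotmul_delta dotmul_legendre.
  rewrite (finsler_homogeneous normH) finsler_legendre gtr0_norm//.
  rewrite mulrDr (mulrC (H0 x) (h * _)) -!mulrA mulVf ?gt_eqF// mulr1.
  by rewrite addrC expr2 (mulrCA c).
Qed.

End finsler_duality.

(** * Integration on row vectors *)

Section continuity_rV.
Context {R : realType}.

Lemma cvg_rV {T : Type} {F : set_system T} {FF : Filter F} n
    (f : T -> 'rV[R]_n) (x : 'rV[R]_n) :
  (forall i, f t ord0 i @[t --> F] --> x ord0 i) -> f @ F --> x.
Proof.
move=> fx; apply/cvgrPdist_le => e e0.
have : \forall t \near F, forall i, `|x ord0 i - f t ord0 i| <= e.
  by apply: filter_forall => i; exact: (@cvgr_dist_le _ R^o _ _ _ _ _ (fx i)).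
apply: filterS => t xt; apply: norm_le_coord; first exact: ltW.
by move=> i; rewrite !mxE.
Qed.

Lemma rV_cons_continuous n : continuous (@rV_cons R n).
Proof.
move=> p; have FF : Filter (nbhs p) := nbhs_filter p.
apply: cvg_rV => i; case: (unliftP ord0 i) => [j ->|->].
  rewrite rV_cons_lift.
  rewrite (_ : (fun _ => _) = (fun q : R * 'rV[R]_n => q.2 ord0 j)); last first.
    by apply/funext => q; rewrite rV_cons_lift.
  apply: (@cvg_comp _ _ _ snd (fun x : 'rV[R]_n => x ord0 j) _ (nbhs p.2)).
    exact: cvg_snd.
  exact: coord_continuous.
rewrite rV_cons_ord0.
rewrite (_ : (fun _ => _) = (fun q : R * 'rV[R]_n => q.1)); last first.
  by apply/funext => q; rewrite rV_cons_ord0.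
exact: cvg_fst.
Qed.

Lemma rV_uncons_continuous n : continuous (@rV_uncons R n).
Proof.
move=> x; have FF : Filter (nbhs x) := nbhs_filter x.
have c1 : y ord0 ord0 @[y --> x] --> x ord0 ord0 by exact: coord_continuous.
have c2 : \row_i y ord0 (lift ord0 i) @[y --> x] --> \row_i x ord0 (lift ord0 i).
  apply: (@cvg_rV _ _ FF n (fun y : 'rV[R]_n.+1 => \row_i y ord0 (lift ord0 i))) => i.
  rewrite mxE; apply: (cvg_trans _ (@coord_continuous R 1 n.+1 ord0 (lift ord0 i) x)).
  by apply: near_eq_cvg; apply: nearW => y; rewrite mxE.
exact: (cvg_pair c1 c2).
Qed.

Lemma continuous_measurable_rV n (f : 'rV[R]_n -> R) :
  continuous f -> measurable_fun setT f.
Proof.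
move=> /continuousP cf; apply: (measurability _ (RGenOpens.measurableE R)).
move=> _ [_ [a [b ->]] <-]; rewrite setTI.
by apply: open_measurable_rV; apply: cf; exact: interval_open.
Qed.

(** The product sigma-algebra is transported to row vectors of length n + 1, where open sets are
    known to be measurable. *)
Lemma continuous_measurable_rV_prod n (f : 'rV[R]_n * R -> R) :
  continuous f -> measurable_fun setT f.
Proof.
move=> cf.
pose g x := f ((@rV_uncons R n x).2, (@rV_uncons R n x).1).
have -> : f = g \o (@rV_cons R n \o (fun z : 'rV[R]_n * R => (z.2, z.1))).
  by apply/funext => -[y s]; rewrite /g /comp (rV_consK (s, y)).
apply: measurableT_comp; last first.
  by apply: measurableT_comp; [exact: measurable_rV_cons|exact: measurable_swap].
apply: continuous_measurable_rV => x; have FF : Filter (nbhs x) := nbhs_filter x.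
apply: (@cvg_comp _ _ _ (fun x => ((@rV_uncons R n x).2, (@rV_uncons R n x).1)) f _
  (nbhs ((@rV_uncons R n x).2, (@rV_uncons R n x).1))); last exact: cf.
have cu := @rV_uncons_continuous n x.
have c2 : (rV_uncons y).2 @[y --> x] --> (rV_uncons x).2.
  by apply: (@cvg_comp _ _ _ _ snd _ (nbhs (rV_uncons x)) _ cu); exact: cvg_snd.
have c1 : (rV_uncons y).1 @[y --> x] --> (rV_uncons x).1.
  by apply: (@cvg_comp _ _ _ _ fst _ (nbhs (rV_uncons x)) _ cu); exact: cvg_fst.
exact: (cvg_pair c2 c1).
Qed.

Lemma is_derive_eq0_near {V : normedModType R} (f : V -> R^o) (a v : V) (d : R) :
  is_derive a v f d -> (\forall b \near a, f b = 0) -> d = 0.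
Proof.
move=> [_ <-] f0; rewrite (near_eq_derive _ (_ : \near a, f a = cst 0 a))//.
exact: derive_cst.
Qed.

End continuity_rV.

(** * Uniformity over compact sets *)

Lemma bounded_on_compact {R : realType} {T : topologicalType} (K : set T) (f : T -> R) :
  compact K -> (forall x, K x -> {for x, continuous f}) ->
  exists2 C : R, 0 <= C & forall x, K x -> `|f x| <= C.
Proof.
move=> cK cf; have : compact (f @` K).
  by apply: continuous_compact cK; apply: continuous_in_subspaceT => x /set_mem/cf.
move=> /(@compact_bounded R R^o) [C [_ /(_ (`|C| + 1))]] CP.
exists (`|C| + 1) => // x Kx; apply: CP; last by exists x.
by rewrite (le_lt_trans (ler_norm _))// ltrDl.
Qed.

(** A tube argument: continuity at each (x, u) gives a product neighbourhood, and compactness of [K]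
    makes the neighbourhood of [u] independent of x. *)
Lemma near_compact_dist {R : realType} {T U : topologicalType} (K : set T)
    (f : T * U -> R) (u : U) (e : R) :
  compact K -> (forall x, K x -> {for (x, u), continuous f}) -> 0 < e ->
  \forall u' \near u, forall x, K x -> `|f (x, u') - f (x, u)| < e.
Proof.
move=> cK cf e0.
apply: ((compact_near_coveringP K).1 cK _ (nbhs u)
  (fun u' x => `|f (x, u') - f (x, u)| < e) _) => x Kx.
have e2 : 0 < e / 2 by rewrite divr_gt0.
have /cvgrPdist_lt /(_ _ e2) [[A B]/= [xA uB] AB] := cf x Kx.
exists (A, B) => // -[x' u'] /= [Ax' Bu']; rewrite (splitr e).
have h1 : `|f (x, u) - f (x', u')| < e / 2 by exact: (AB (x', u')).
have h2 : `|f (x, u) - f (x', u)| < e / 2.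
  by apply: (AB (x', u)); split => //=; exact: nbhs_singleton.
rewrite -(subrKA (f (x, u))) (le_lt_trans (ler_normD _ _))//.
by rewrite ltrD// distrC.
Qed.

Lemma bounded_integrable {R : realType} {d} {T : measurableType d} (m : {measure set T -> \bar R})
    (D : set T) (f : T -> R) (C : R) : measurable D -> (m D < +oo)%E ->
  measurable_fun D f -> (forall x, D x -> `|f x| <= C) -> m.-integrable D (EFin \o f).
Proof.
move=> mD Dfin mf fC; apply: measurable_bounded_integrable => //.
exists C; split; first exact: num_real.
by move=> c Cc x /= /fC/le_trans; apply; exact: ltW.
Qed.

(** * Integrability and Fubini for functions of row vectors *)

Section integration_rV.
Context {R : realType}.
Local Notation leb := (lebesgue_rV R _).
Implicit Types (n : nat) (M C : R).

Lemma measurable_le_continuous_rV n (f : 'rV[R]_n -> R) M :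
  continuous f -> measurable [set y | f y <= M].
Proof.
move=> /continuous_measurable_rV mf; have := mf measurableT _ (@measurable_itv _ `]-oo, M]).
by rewrite setTI; congr measurable.
Qed.

Lemma measurable_lt_continuous_rV n (f : 'rV[R]_n -> R) M :
  continuous f -> measurable [set y | f y < M].
Proof.
move=> /continuous_measurable_rV mf; have := mf measurableT _ (@measurable_itv _ `]-oo, M[).
by rewrite setTI; congr measurable.
Qed.

Lemma measurable_closed_box n M : measurable [set y : 'rV[R]_n | `|y| <= M].
Proof. by apply: measurable_le_continuous_rV; exact: norm_continuous. Qed.

Lemma lebesgue_closed_box_le n (x : 'rV[R]_n) M : 0 <= M ->
  (leb [set y | `|y - x|%R <= M]%R <= ((2 * M) ^+ n)%:E)%E.
Proof.
move=> M0; pose B i := [set` `[x ord0 i - M, x ord0 i + M]].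
have mB i : measurable (B i) by exact: measurable_itv.
apply: (@le_trans _ _ (leb [set y : 'rV_n | forall i, B i (y ord0 i)])).
  apply: le_measure; rewrite ?inE.
  - apply: measurable_le_continuous_rV => y; have FF : Filter (nbhs y) := nbhs_filter y.
    by apply: cvg_norm; apply: cvgB; [exact: cvg_id|exact: cvg_cst].
  - exact: measurable_rV_box.
  - move=> y /= yx i; rewrite /B /= in_itv /= -ler_distl.
    by apply: le_trans yx; have := norm_coord_le (y - x) i; rewrite !mxE.
rewrite lebesgue_rV_box// (eq_bigr (fun=> (2 * M)%:E)) => [|i _].
  by rewrite prodEFin big_const_ord iter_mulr_1.
rewrite /B lebesgue_measure_itv /= lte_fin; case: ltP => [_|le0].
  by rewrite -EFinB; congr _%:E; lra.
by congr _%:E; lra.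
Qed.

Lemma lebesgue_bounded_fin n M (D : set 'rV[R]_n) : measurable D ->
  (forall y, D y -> `|y| <= M) -> (leb D < +oo)%E.
Proof.
move=> mD DM; have [->|/set0P[y Dy]] := eqVneq D set0; first by rewrite measure0.
apply: (@le_lt_trans _ _ (leb [set y : 'rV[R]_n | `|y - 0| <= M]%R)).
  apply: le_measure; rewrite ?inE//.
    rewrite (_ : mkset _ = [set y : 'rV[R]_n | `|y| <= M]); first exact: measurable_closed_box.
    by apply/seteqP; split => z /=; rewrite subr0.
  by move=> z /DM /=; rewrite subr0.
apply: le_lt_trans (ltry _); apply: lebesgue_closed_box_le.
exact: le_trans (DM _ Dy).
Qed.

Lemma continuous_integrable_bounded n M (D : set 'rV[R]_n) (f : 'rV[R]_n -> R) :
  measurable D -> (forall y, D y -> `|y| <= M) -> continuous f ->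
  leb.-integrable D (EFin \o f).
Proof.
move=> mD DM cf; have [C _ fC] := bounded_on_compact (@compact_closed_box _ _ M) (fun y _ => cf y).
apply: (bounded_integrable (C := C)) => //.
- exact: lebesgue_bounded_fin DM.
- by apply: measurable_funTS; exact: continuous_measurable_rV.
- by move=> y /DM/fC.
Qed.

Lemma continuous_integrable_supp n M (f : 'rV[R]_n -> R) :
  continuous f -> (forall y, M < `|y| -> f y = 0) -> leb.-integrable setT (EFin \o f).
Proof.
move=> cf f0; have mM := @measurable_closed_box n M.
have := continuous_integrable_bounded mM (fun y yM => yM) cf.
move=> /(integrable_mkcond _ mM); congr (_.-integrable _ _).
apply/funext => y /=; rewrite patchE; case: ifPn => //.
by rewrite notin_setE /= => /negP; rewrite -ltNge => /f0 ->.
Qed.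

(** The measure in length n + 1 is by construction the image of a product measure under [rV_cons];
    the pushforward formula moves integrability to the product, where Fubini applies. *)
Lemma integrable_rV_cons n (f : 'rV[R]_n.+1 -> R) :
  leb.-integrable setT (EFin \o f) ->
  ((@lebesgue_measure R \x lebesgue_rV R n)%E).-integrable setT
    (fun p => (f (rV_cons p))%:E).
Proof.
move=> /integrableP[/measurable_EFinP mf fi]; apply/integrableP; split.
  by apply/measurable_EFinP; apply: measurableT_comp => //; exact: measurable_rV_cons.
have mf' : measurable_fun setT (fun x => `|(f x)%:E|%E).
  by apply/measurable_EFinP; exact: measurableT_comp.
have := @ge0_integral_pushforward _ _ (measurableTypeR R * 'rV[R]_n)%type _ R _
  (@measurable_rV_cons R n)
  (@lebesgue_measure R \x lebesgue_rV R n)%E setT (fun x => `|(f x)%:E|%E) measurableT mf'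
  (fun=> fun=> abse_ge0 _).
rewrite preimage_setT => E; apply: le_lt_trans fi; rewrite le_eqVlt; apply/orP; left.
apply/eqP; apply/esym/(etrans _ E).
by apply: eq_measure_integral; first exact: measurable_rV_cons.
Qed.

Lemma integral_lebesgue_rVS n (f : 'rV[R]_n.+1 -> R) :
  leb.-integrable setT (EFin \o f) ->
  (\int[lebesgue_rV R n.+1]_x (f x)%:E =
   \int[@lebesgue_measure R \x lebesgue_rV R n]_p (f (rV_cons p))%:E)%E.
Proof.
move=> fi; have /integrableP[mf _] := fi.
have := @integral_pushforward _ _ (measurableTypeR R * 'rV[R]_n)%type _ R _
  (@measurable_rV_cons R n)
  (@lebesgue_measure R \x lebesgue_rV R n)%E setT (EFin \o f) mf
  (integrable_rV_cons fi) measurableT.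
rewrite preimage_setT => E; apply: (etrans _ E).
rewrite -[LHS]/(\int[lebesgue_rV R n.+1]_x (EFin \o f) x)%E.
by apply: eq_measure_integral; first exact: measurable_rV_cons.
Qed.

Lemma integral_derivative_supp M (g dg : R -> R) : continuous dg ->
  (forall a : R, is_derive a 1 g (dg a)) -> (forall a, M < `|a| -> g a = 0) ->
  (\int[lebesgue_measure]_a (dg a)%:E = 0)%E.
Proof.
(* This choice keeps [-m, m] nondegenerate even for nonpositive [M], with [g] zero at both ends. *)
move=> cdg gdg g0; pose m : R := `|M| + 1.
have m0 : 0 < m by rewrite ltr_wpDl.
have Mm : M < m by rewrite (le_lt_trans (ler_norm _))// ltrDl.
have dg0 a : M < `|a| -> dg a = 0.
  move=> Ma; apply: (is_derive_eq0_near (gdg a)).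
  have : \forall b \near a, M < `|b|.
    exact: (cvgr_gt _ (@norm_continuous R R^o a)).
  by apply: filterS => b; exact: g0.
transitivity (\int[lebesgue_measure]_(a in `[(- m)%R, m]) (dg a)%:E)%E.
  rewrite [RHS]integral_mkcond; apply: eq_integral => a _; rewrite patchE.
  case: ifPn => //; rewrite notin_setE /= in_itv /= -ler_norml => /negP.
  by rewrite -ltNge => /(lt_trans Mm)/dg0 ->.
have cg : continuous g.
  move=> a; apply: differentiable_continuous; apply/derivable1_diffP.
  exact: (@ex_derive _ _ _ _ _ _ _ (gdg a)).
rewrite (@continuous_FTC2 _ dg g)//.
- by rewrite !g0 ?subee// ?normrN ger0_norm// ltW.
- by rewrite gtrN.
- exact: continuous_subspaceT.
- split.
  + by move=> a _; exact: (@ex_derive _ _ _ _ _ _ _ (gdg a)).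
  + exact/cvg_at_right_filter/cg.
  + exact/cvg_at_left_filter/cg.
- by move=> a _; rewrite derive1E (@derive_val _ _ _ _ _ _ _ (gdg a)).
Qed.

Lemma rV_consDZ n (h : R) (p q : R * 'rV[R]_n) :
  h *: rV_cons p + rV_cons q = rV_cons (h *: p.1 + q.1, h *: p.2 + q.2).
Proof.
apply/rowP => i; case: (unliftP ord0 i) => [j ->|->].
  by rewrite mxE mxE !rV_cons_lift !mxE.
by rewrite mxE mxE !rV_cons_ord0.
Qed.

Lemma rV_cons_delta0 n : rV_cons (1, 0) = delta_mx ord0 ord0 :> 'rV[R]_n.+1.
Proof.
apply/rowP => i; case: (unliftP ord0 i) => [j ->|->].
  by rewrite rV_cons_lift !mxE.
by rewrite rV_cons_ord0 !mxE !eqxx.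
Qed.

Lemma rV_cons_delta_lift n (j : 'I_n) :
  rV_cons (0, delta_mx ord0 j) = delta_mx ord0 (lift ord0 j) :> 'rV[R]_n.+1.
Proof.
apply/rowP => i; case: (unliftP ord0 i) => [k ->|->].
  by rewrite rV_cons_lift !mxE (inj_eq (@lift_inj _ _)).
by rewrite rV_cons_ord0 !mxE.
Qed.

(* Fubini along the first coordinate; the other coordinates by induction on [n]. *)
Lemma integral_partial_supp n (i : 'I_n) M (g dg : 'rV[R]_n -> R) : continuous dg ->
  (forall x, is_derive x (delta_mx ord0 i) (g : _ -> R^o) (dg x)) ->
  (forall x, M < `|x| -> g x = 0) ->
  (\int[leb]_x (dg x)%:E = 0)%E.
Proof.
elim: n i g dg => [[]//|n IH] i g dg cdg gdg g0.
have dg0 x : M < `|x| -> dg x = 0.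
  move=> Mx; apply: (is_derive_eq0_near (gdg x)).
  have : \forall y \near x, M < `|y| by exact: (cvgr_gt _ (@norm_continuous _ _ x)).
  by apply: filterS => y; exact: g0.
have idg := continuous_integrable_supp cdg dg0.
rewrite integral_lebesgue_rVS//.
have cons1 (p : R * 'rV[R]_n) : `|p.1| <= `|rV_cons p|.
  by have := norm_coord_le (rV_cons p) ord0; rewrite rV_cons_ord0.
have cons2 (p : R * 'rV[R]_n) : `|p.2| <= `|rV_cons p|.
  apply: norm_le_coord => // j.
  by have := norm_coord_le (rV_cons p) (lift ord0 j); rewrite rV_cons_lift.
case: (unliftP ord0 i) gdg => [j ->|->] gdg.
  rewrite -integral12_prod_meas1; last exact: integrable_rV_cons.
  rewrite (eq_integral (fun=> 0%E)) ?integral0// => a _; rewrite /fubini_F /=.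
  apply: (IH j (fun y => g (rV_cons (a, y)))).
  - move=> y; apply: (@cvg_comp _ _ _ (fun y => rV_cons (a, y)) dg _ (nbhs (rV_cons (a, y)))).
      apply: (@cvg_comp _ _ _ (fun y => (a, y)) (@rV_cons R n) _ (nbhs (a, y))).
        have Fa : Filter (nbhs a) := nbhs_filter a.
        have Fy : Filter (nbhs y) := nbhs_filter y.
        exact: (@cvg_pair _ _ _ (nbhs y) (nbhs a) (nbhs y) Fy Fa Fy (cst a) id
          (cvg_cst a) cvg_id).
      exact: rV_cons_continuous.
    exact: cdg.
  - move=> y; apply: cvg_is_derive; have := is_derive_cvg (gdg (rV_cons (a, y))).
    apply: cvg_trans; apply: near_eq_cvg; near=> h.
    by rewrite -rV_cons_delta_lift rV_consDZ /= scaler0 add0r.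
  - by move=> y My; apply: g0; apply: (lt_le_trans My); exact: (cons2 (a, y)).
rewrite -integral21_prod_meas1; last exact: integrable_rV_cons.
rewrite (eq_integral (fun=> 0%E)) ?integral0// => y _; rewrite /fubini_G /=.
apply: (@integral_derivative_supp M (fun a => g (rV_cons (a, y)))).
- move=> a; apply: (@cvg_comp _ _ _ (fun a => rV_cons (a, y)) dg _ (nbhs (rV_cons (a, y)))).
    apply: (@cvg_comp _ _ _ (fun a => (a, y)) (@rV_cons R n) _ (nbhs (a, y))).
      have Fa : Filter (nbhs a) := nbhs_filter a.
      have Fy : Filter (nbhs y) := nbhs_filter y.
      exact: (@cvg_pair _ _ _ (nbhs a) (nbhs a) (nbhs y) Fa Fa Fy id (cst y)
        cvg_id (cvg_cst y)).
    exact: rV_cons_continuous.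
  exact: cdg.
- move=> a; apply: cvg_is_derive; have := is_derive_cvg (gdg (rV_cons (a, y))).
  apply: cvg_trans; apply: near_eq_cvg; near=> h.
  by rewrite -rV_cons_delta0 rV_consDZ /= scaler0 add0r.
- by move=> a Ma; apply: g0; apply: (lt_le_trans Ma); exact: (cons1 (a, y)).
Unshelve. all: by end_near.
Qed.

End integration_rV.

Section convergence_L1.
Context {R : realType}.

Lemma cvg_L1_dist n (D : set 'rV[R]_n) (M : R) (f : 'rV[R]_n * R -> R) (t : R) :
  measurable D -> (forall y, D y -> `|y| <= M) ->
  (forall y, {for (y, t), continuous f}) ->
  (forall s, measurable_fun D (fun y => f (y, s))) ->
  (\int[lebesgue_rV R n]_(y in D) `|f (y, s) - f (y, t)|%:E)%E @[s --> t] --> 0%E.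
Proof.
move=> mD DM cf mf; set I := fun s => _.
have Dfin := lebesgue_bounded_fin mD DM.
have Dnum : lebesgue_rV R n D \is a fin_num by rewrite ge0_fin_numE.
(* The added 1 keeps the divisor positive when [D] is null. *)
pose d := fine (lebesgue_rV R n D) + 1.
have d0 : 0 < d by rewrite ltr_wpDl// fine_ge0.
have I_ge0 s : (0 <= I s)%E by apply: integral_ge0 => y _; rewrite lee_fin.
have nearI (e : R) : 0 < e -> \forall s \near t, (I s <= e%:E)%E.
  move=> e0; have ed : 0 < e / d by rewrite divr_gt0.
  have := near_compact_dist (@compact_closed_box R n M) (fun y _ => cf y) ed.
  apply: filterS => s sP.
  apply: (@le_trans _ _ ((e / d)%:E * lebesgue_rV R n D)%E); last first.
    rewrite -(fineK Dnum) -EFinM lee_fin mulrAC ler_pdivrMr// ler_wpM2l//.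
      exact: ltW.
    by rewrite lerDl.
  apply: (@le_trans _ _ (\int[lebesgue_rV R n]_(y in D)
      `|(f (y, s) - f (y, t))%:E|)%E); first by [].
  apply: integral_le_bound => //.
  - by apply/measurable_EFinP; apply: measurable_funB.
  - by rewrite lee_fin ltW.
  - by apply/aeW => y /DM /sP/ltW.
apply/fine_cvgP; split.
  have := nearI 1 ltr01; apply: filterS => s I1.
  by rewrite ge0_fin_numE// (le_lt_trans I1)// ltry.
apply/cvgrPdist_le => e e0; have := nearI e e0; apply: filterS => s Ie.
rewrite sub0r normrN ger0_norm ?fine_ge0//= -lee_fin fineK//.
by rewrite ge0_fin_numE// (le_lt_trans Ie)// ltry.
Qed.

End convergence_L1.

(** * Exchange of real-valued iterated integrals *)

Section exchange.
Context {R : realType} d1 d2 (T1 : measurableType d1) (T2 : measurableType d2).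
Variables (m1 : {sigma_finite_measure set T1 -> \bar R}).
Variables (m2 : {sigma_finite_measure set T2 -> \bar R}).

(** A bounded function on a product of sets of finite measure is integrable, so Fubini applies to
    its extension by zero. Passing to real values is harmless because every section has a finite
    integral. *)
Lemma Rintegral_exchange_bounded (D1 : set T1) (D2 : set T2) (f : T1 * T2 -> R) (C : R) :
  measurable D1 -> measurable D2 -> (m1 D1 < +oo)%E -> (m2 D2 < +oo)%E ->
  measurable_fun (D1 `*` D2) f ->
  (forall x y, D1 x -> D2 y -> `|f (x, y)| <= C) ->
  \int[m1]_(x in D1) \int[m2]_(y in D2) f (x, y) =
  \int[m2]_(y in D2) \int[m1]_(x in D1) f (x, y).
Proof.
move=> mD1 mD2 D1fin D2fin mf fC.
have mD : measurable (D1 `*` D2) by exact: measurableX.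
have fi : (m1 \x m2)%E.-integrable (D1 `*` D2) (EFin \o f).
  apply: (bounded_integrable (C := C)) => //.
    by rewrite [X in (X < _)%E]product_measure1E// lte_mul_pinfty// ge0_fin_numE.
  by move=> [x y] [/= D1x D2y]; exact: fC.
have /Fubini := (integrable_mkcond _ mD).1 fi.
have mf1 x : D1 x -> measurable_fun D2 (fun y => f (x, y)).
  move=> D1x; have := mf; rewrite (measurable_restrictT _ mD) => mfD.
  have : measurable_fun setT ((f \_ (D1 `*` D2)) \o pair x).
    by apply: measurableT_comp => //; exact: pair1_measurable.
  move=> /(measurable_funS measurableT (@subsetT _ D2)).
  apply: eq_measurable_fun => y /set_mem D2y /=.
  by rewrite patchE mem_set.
have mf2 y : D2 y -> measurable_fun D1 (fun x => f (x, y)).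
  move=> D2y; have := mf; rewrite (measurable_restrictT _ mD) => mfD.
  have : measurable_fun setT ((f \_ (D1 `*` D2)) \o pair^~ y).
    by apply: measurableT_comp => //; exact: pair2_measurable.
  move=> /(measurable_funS measurableT (@subsetT _ D1)).
  apply: eq_measurable_fun => x /set_mem D1x /=.
  by rewrite patchE mem_set.
have i1 x : D1 x -> m2.-integrable D2 (EFin \o (fun y => f (x, y))).
  move=> D1x; apply: (bounded_integrable (C := C)) => //; first exact: mf1.
  by move=> y D2y; exact: fC.
have i2 y : D2 y -> m1.-integrable D1 (EFin \o (fun x => f (x, y))).
  move=> D2y; apply: (bounded_integrable (C := C)) => //; first exact: mf2.
  by move=> x D1x; exact: fC.
move=> E; rewrite /Rintegral; congr fine.
transitivity (\int[m1]_x \int[m2]_y ((EFin \o f) \_ (D1 `*` D2)) (x, y))%E.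
  rewrite integral_mkcond; apply: eq_integral => x _; rewrite patchE.
  case: ifPn => [/set_mem D1x|D1x].
    rewrite fineK; last exact: (integrable_fin_num mD2 (i1 x D1x)).
    rewrite integral_mkcond; apply: eq_integral => y _; rewrite !patchE.
    by rewrite in_setX (mem_set D1x).
  apply/esym; rewrite (eq_integral (fun=> 0%E)) ?integral0// => y _.
  by rewrite patchE in_setX (negbTE D1x).
rewrite {}E [RHS]integral_mkcond; apply: eq_integral => y _; rewrite patchE.
case: ifPn => [/set_mem D2y|D2y].
  rewrite fineK; last exact: (integrable_fin_num mD1 (i2 y D2y)).
  rewrite [RHS]integral_mkcond; apply: eq_integral => x _; rewrite !patchE.
  by rewrite in_setX (mem_set D2y) andbT.
rewrite (eq_integral (fun=> 0%E)) ?integral0// => x _.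
by rewrite patchE in_setX (negbTE D2y) andbF.
Qed.

End exchange.

(** * Integration against a measure with density *)

Section density.
Context {R : realType} {n : nat}.
Variables (f : 'rV[R]_n -> R) (mf : measurable_fun setT f).
Local Notation leb := (lebesgue_rV R n).
Local Notation w := (fun y => (Num.max (f y) 0)%:E).

Let mw : measurable_fun setT w.
Proof.
apply/measurable_EFinP; apply: measurable_maxr => //; exact: measurable_cst.
Qed.

Let w0 y : (0 <= w y)%E. Proof. by rewrite lee_fin le_max lexx orbT. Qed.

Import HBNNSimple.

Let density_nnsfun (h : {nnsfun 'rV[R]_n >-> R}) :
  (\int[pos_density mf]_x (h x)%:E = \int[leb]_x ((h x)%:E * w x))%E.
Proof.
rewrite integralT_nnsfun sintegralE.
pose F r x := (r%:E * ((\1_(h @^-1` [set r]) x)%:E * w x))%E.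
have m1 r : measurable_fun setT (fun x : 'rV[R]_n => (\1_(h @^-1` [set r]) x)%:E * w x)%E.
  by apply: emeasurable_funM => //; exact/measurable_EFinP.
transitivity (\int[leb]_x \sum_(r \in range h) F r x)%E; last first.
  apply: eq_integral => x _; rewrite [in RHS]fimfunE -fsumEFin// ge0_mule_fsuml.
    by apply: eq_fsbigr => r _; rewrite /F EFinM muleA.
  by move=> r; exact: nnfun_muleindic_ge0.
have F0 r x : (0 <= F r x)%E.
  by rewrite /F muleA mule_ge0// nnfun_muleindic_ge0.
rewrite ge0_integral_fsum//; last first.
  by move=> r; apply: emeasurable_funM.
apply: eq_fsbigr => r /set_mem [x _ <-]; rewrite /F.
rewrite ge0_integralZl ?lee_fin//; last by move=> y _; rewrite mule_ge0.
congr (_ * _)%E; rewrite /= /pos_density integral_mkcond.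
by apply: eq_integral => y _; rewrite epatch_indic muleC.
Qed.

(** Monotone convergence, on both sides, along an increasing sequence of simple functions tending to
    [h]. *)
Lemma ge0_integral_pos_density (h : 'rV[R]_n -> \bar R) :
  measurable_fun setT h -> (forall x, 0 <= h x)%E ->
  (\int[pos_density mf]_x h x = \int[leb]_x (h x * w x))%E.
Proof.
move=> mh h0; pose g := nnsfun_approx measurableT mh.
have gh x : (g k x)%:E @[k --> \oo] --> h x by exact: cvg_nnsfun_approx.
have gnd x : {homo (fun k => (g k x)%:E) : k l / (k <= l)%N >-> (k <= l)%E}.
  by move=> k l kl; rewrite lee_fin; exact/lefP/nd_nnsfun_approx.
transitivity (limn (fun k => \int[pos_density mf]_x (g k x)%:E)%E).
  rewrite -monotone_convergence//.
  - by apply: eq_integral => x _; apply/esym/cvg_lim => //; exact: gh.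
  - by move=> k; exact/measurable_EFinP.
  - by move=> k x _; rewrite lee_fin.
transitivity (limn (fun k => \int[leb]_x ((g k x)%:E * w x))%E).
  by congr (limn _); apply/funext => k; exact: density_nnsfun.
rewrite -monotone_convergence//.
- by apply: eq_integral => x _; apply/cvg_lim => //; apply: cvgeZr => //; exact: gh.
- by move=> k; apply: emeasurable_funM => //; exact/measurable_EFinP.
- by move=> k x _; rewrite mule_ge0// lee_fin.
- by move=> x _ k l kl; rewrite lee_wpmul2r// gnd.
Qed.

Lemma integral_pos_density (h : 'rV[R]_n -> R) : measurable_fun setT h ->
  (forall x, 0 <= f x) ->
  \int[pos_density mf]_x h x = \int[leb]_x (h x * f x).
Proof.
move=> mh f0; have mEh : measurable_fun setT (EFin \o h) by exact/measurable_EFinP.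
rewrite /Rintegral; congr fine; rewrite integralE [RHS]integralE.
rewrite ge0_integral_pos_density//; last exact: measurable_funepos.
rewrite ge0_integral_pos_density//; last exact: measurable_funeneg.
congr (_ - _)%E; apply: eq_integral => x _.
  by rewrite !funeposE /= (max_l (f0 x)) -!EFin_max -EFinM maxr_pMl// mul0r.
by rewrite !funenegE /= (max_l (f0 x)) -!EFin_max -EFinM maxr_pMl// mul0r mulNr.
Qed.

End density.

(** * The explicit solution *)

Section line_derivatives.
Context {R : realType} {V : normedModType R}.
Implicit Types (f : V -> R) (a v : V).

Lemma is_derive_line f a v (d : R) :
  is_derive a v (f : V -> R^o) d <-> is_derive (0 : R) 1 (fun h => f (h *: v + a)) d.
Proof.
split => /is_derive_cvg fd; apply: cvg_is_derive; apply: cvg_trans fd;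
  apply: near_eq_cvg; apply: nearW => h /=.
- by rewrite !addr0 scale0r add0r [_%:A]mulr1.
- by rewrite !addr0 scale0r add0r [_%:A]mulr1.
Qed.

(** Only a directional derivative of [f] is at hand, so the one-variable chain rule is applied on
    the line through [a] in direction [v]. *)
Lemma is_derive_comp_real f (g : R -> R) a v (df dg : R) :
  is_derive a v (f : V -> R^o) df -> is_derive (f a) 1 g dg ->
  is_derive a v (g \o f : V -> R^o) (dg * df).
Proof.
move=> /is_derive_line fd gd; apply/is_derive_line.
by apply: (@is_derive1_comp _ g); rewrite scale0r add0r.
Qed.

End line_derivatives.

Lemma is_derive_inv_real {R : realType} (f : R -> R) (a v df : R) : f a != 0 ->
  is_derive a v f df -> is_derive a v (fun b => (f b)^-1) (- (f a) ^- 2 * df).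
Proof.
move=> fa0 [dfa <-]; apply: DeriveDef; first exact: derivableV.
exact: deriveV.
Qed.

(** * Divergence theorem and integration by parts without boundary terms *)

Section integration_by_parts.
Context {R : realType} {n : nat}.
Local Notation leb := (lebesgue_rV R n).

Lemma Rintegral_divergence_supp (M : R) (g dg : 'I_n -> 'rV[R]_n -> R) :
  (forall i, continuous (dg i)) ->
  (forall i x, is_derive x (delta_mx ord0 i) (g i : _ -> R^o) (dg i x)) ->
  (forall i x, M < `|x| -> g i x = 0) -> (forall i x, M < `|x| -> dg i x = 0) ->
  \int[leb]_x (\sum_(i < n) dg i x) = 0.
Proof.
move=> cdg gdg g0 dg0; rewrite /Rintegral.
under eq_integral do rewrite -sumEFin.
rewrite integral_sum//; last by move=> i; exact: continuous_integrable_supp (dg0 i).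
by rewrite big1// => i _; exact: integral_partial_supp (g0 i).
Qed.

Lemma Rintegral_by_parts_supp (i : 'I_n) (M : R) (f df psi dpsi : 'rV[R]_n -> R) :
  continuous f -> continuous df -> continuous psi -> continuous dpsi ->
  (forall x, is_derive x (delta_mx ord0 i) (f : _ -> R^o) (df x)) ->
  (forall x, is_derive x (delta_mx ord0 i) (psi : _ -> R^o) (dpsi x)) ->
  (forall x, M < `|x| -> psi x = 0) -> (forall x, M < `|x| -> dpsi x = 0) ->
  \int[leb]_x (f x * dpsi x) = - \int[leb]_x (df x * psi x).
Proof.
move=> cf cdf cpsi cdpsi fd psid psi0 dpsi0.
have c1 : continuous (fun x => f x * dpsi x).
  move=> x; have FF : Filter (nbhs x) := nbhs_filter x.
  by apply: cvgM; [exact: cf|exact: cdpsi].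
have c2 : continuous (fun x => df x * psi x).
  move=> x; have FF : Filter (nbhs x) := nbhs_filter x.
  by apply: cvgM; [exact: cdf|exact: cpsi].
have i1 := continuous_integrable_supp c1
  (fun x Mx => etrans (congr1 ( *%R (f x)) (dpsi0 x Mx)) (mulr0 _)).
have i2 := continuous_integrable_supp c2
  (fun x Mx => etrans (congr1 ( *%R (df x)) (psi0 x Mx)) (mulr0 _)).
apply/eqP; rewrite -addr_eq0 -RintegralD//; apply/eqP.
have c12 : continuous (fun x => f x * dpsi x + df x * psi x).
  move=> x; have FF : Filter (nbhs x) := nbhs_filter x.
  by apply: cvgD; [exact: c1|exact: c2].
have d12 x : is_derive x (delta_mx ord0 i) ((fun x => f x * psi x) : _ -> R^o)
    (f x * dpsi x + df x * psi x).
  have := is_deriveM (fd x) (psid x).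
  by move=> /is_derive_eq; apply; congr (_ + _); rewrite mulrC.
by rewrite /Rintegral (integral_partial_supp c12 d12 (M := M))// => x /psi0 ->; rewrite mulr0.
Qed.

End integration_by_parts.

(** * Derivatives, flux, minimum and blow-up of the solution *)

Section gaussian.
Context {R : realType} {N : nat}.
Variables (H : 'rV[R]_N -> R) (Lambda : R).
Hypotheses (N_gt0 : (0 < N)%N) (normH : finsler_norm H).
Hypothesis sconvH : strictly_convex_set [set xi | H xi < 1].
Hypothesis Lambda_gt0 : 0 < Lambda.
Local Notation H0 := (dual_norm H).
Local Notation T := (4 * Lambda)^-1.
Local Notation lam s := (1 - 4 * Lambda * s).
Local Notation e_ i := (delta_mx ord0 i).

Definition gaussian (x : 'rV[R]_N) (t : R) : R :=
  lam t `^ (- (N%:R / 2)) * expR (Lambda * H0 x ^+ 2 / lam t).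

Definition gaussian_grad (x : 'rV[R]_N) (t : R) : 'rV[R]_N :=
  (2 * Lambda / lam t * gaussian x t) *: legendre H x.

(** Written as the divergence of the flux (2 Lambda / lam) v x: N v comes from div x, the pairing
    from grad v. That it is also the time derivative is [gaussian_is_derive_t]. *)
Definition gaussian_dt (x : 'rV[R]_N) (t : R) : R :=
  2 * Lambda / lam t * (N%:R * gaussian x t + dotmul x (gaussian_grad x t)).

Let v := gaussian.
Let gu := gaussian_grad.

Lemma lam_gt0 s : s < T -> 0 < lam s.
Proof.
move=> sT; rewrite subr_gt0 -(@ltr_pM2l _ (4 * Lambda)^-1) ?invr_gt0 ?mulr_gt0//.
by rewrite mulr1 mulKf// gt_eqF// mulr_gt0.
Qed.

Lemma gaussian_gt0 x s : s < T -> 0 < v x s.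
Proof. by move=> sT; rewrite mulr_gt0 ?powR_gt0 ?expR_gt0// lam_gt0. Qed.

Lemma gaussian_ge0 x s : 0 <= v x s.
Proof. by rewrite mulr_ge0 ?powR_ge0 ?expR_ge0. Qed.

(** The base of the power is positive because s < T, so the power is the exponential of a logarithm.
    This single exponential is the form that is differentiated in time. *)
Lemma gaussianE x s : s < T ->
  v x s = expR (Lambda * H0 x ^+ 2 / lam s - N%:R / 2 * ln (lam s)).
Proof.
move=> sT; rewrite /v /gaussian /powR gt_eqF ?lam_gt0// -expRD; congr expR.
by rewrite addrC mulNr.
Qed.

Let sqr_continuous : continuous (fun x => H0 x ^+ 2).
Proof.
move=> x; have FF : Filter (nbhs x) := nbhs_filter x.
by apply: cvgM; exact: (dual_norm_continuous N_gt0 normH).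
Qed.

Let lam_continuous : continuous (fun s : R => lam s).
Proof. by move=> s; apply: cvgB; [exact: cvg_cst|apply: cvgM; [exact: cvg_cst|exact: cvg_id]]. Qed.

Let cvgz1 (x : 'rV[R]_N) (s : R) : z.1 @[z --> ((x, s) : 'rV[R]_N * R)] --> x.
Proof. exact: cvg_fst. Qed.

Let cvgz2 (x : 'rV[R]_N) (s : R) : z.2 @[z --> ((x, s) : 'rV[R]_N * R)] --> s.
Proof. exact: cvg_snd. Qed.

Let cvg_comp1 {U : topologicalType} (f : 'rV[R]_N -> U) (x : 'rV[R]_N) (s : R) :
  continuous f -> f z.1 @[z --> ((x, s) : 'rV[R]_N * R)] --> f x.
Proof.
by move=> cf; apply: (@cvg_comp _ _ _ fst f _ (nbhs x)); [exact: cvgz1|exact: cf].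
Qed.

Let cvg_lam (x : 'rV[R]_N) (s : R) : lam z.2 @[z --> ((x, s) : 'rV[R]_N * R)] --> lam s.
Proof.
by apply: (@cvg_comp _ _ _ snd (fun s => lam s) _ (nbhs s)); [exact: cvgz2|exact: lam_continuous].
Qed.

Let near_T (x : 'rV[R]_N) (s : R) : s < T ->
  \forall z \near ((x, s) : 'rV[R]_N * R), z.2 < T.
Proof.
by move=> sT; exact: (@cvgz2 x s [set r | r < T] (@cvgr_lt _ _ (nbhs s) _ id s cvg_id _ sT)).
Qed.

Lemma gaussian_continuous x s : s < T ->
  {for (x, s), continuous (fun z : 'rV[R]_N * R => v z.1 z.2)}.
Proof.
move=> sT; suff : v z.1 z.2 @[z --> ((x, s) : 'rV[R]_N * R)] --> v x s by [].
rewrite (gaussianE _ sT).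
have E : {near ((x, s) : 'rV[R]_N * R), (fun z => expR (Lambda * H0 z.1 ^+ 2 / lam z.2 -
    N%:R / 2 * ln (lam z.2))) =1 (fun z => v z.1 z.2)}.
  by apply: filterS (near_T x sT) => z zT; rewrite gaussianE.
apply: cvg_trans (near_eq_cvg E) _.
apply: (@cvg_comp _ _ _ _ expR _ (nbhs (Lambda * H0 x ^+ 2 / lam s - N%:R / 2 * ln (lam s))));
  last exact: continuous_expR.
have ls : lam s != 0 by rewrite gt_eqF// lam_gt0.
apply: cvgB.
  apply: cvgM; last by apply: cvgV => //; exact: cvg_lam.
  by apply: cvgM; [exact: cvg_cst|exact: (@cvg_comp1 R (fun x => H0 x ^+ 2))].
apply: cvgM; first exact: cvg_cst.
apply: (@cvg_comp _ _ _ _ (@ln R) _ (nbhs (lam s))); first exact: cvg_lam.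
by apply: continuous_ln; rewrite lam_gt0.
Qed.

Lemma gaussian_grad_continuous i x s : s < T ->
  {for (x, s), continuous (fun z : 'rV[R]_N * R => gu z.1 z.2 ord0 i)}.
Proof.
move=> sT; have ls : lam s != 0 by rewrite gt_eqF// lam_gt0.
suff : 2 * Lambda / lam z.2 * v z.1 z.2 * legendre H z.1 ord0 i
    @[z --> ((x, s) : 'rV[R]_N * R)] --> 2 * Lambda / lam s * v x s * legendre H x ord0 i.
  rewrite (_ : _ * _ * legendre H x ord0 i = gu x s ord0 i); last by rewrite mxE.
  by apply: cvg_trans; apply: near_eq_cvg; apply: nearW => z; rewrite mxE.
apply: cvgM.
  apply: cvgM; last exact: gaussian_continuous.
  by apply: cvgM; [exact: cvg_cst|apply: cvgV => //; exact: cvg_lam].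
apply: (@cvg_comp1 R (fun x => legendre H x ord0 i)) => y.
apply: (@cvg_comp _ _ _ _ (fun z : 'rV[R]_N => z ord0 i) _ (nbhs (legendre H y))).
  exact: (legendre_continuous N_gt0 normH sconvH).
exact: coord_continuous.
Qed.

Lemma gaussian_dt_continuous x s : s < T ->
  {for (x, s), continuous (fun z : 'rV[R]_N * R => gaussian_dt z.1 z.2)}.
Proof.
move=> sT; have ls : lam s != 0 by rewrite gt_eqF// lam_gt0.
apply: cvgM; first by apply: cvgM; [exact: cvg_cst|apply: cvgV => //; exact: cvg_lam].
apply: cvgD; first by apply: cvgM; [exact: cvg_cst|exact: gaussian_continuous].
apply: cvg_dotmul; first exact: cvgz1.
by apply: cvg_rV => i; exact: gaussian_grad_continuous.
Qed.

(** In x alone [lam s] is a constant and the computation is formal in it, whatever its sign; this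
    lets [gaussian_W11] hold at every time. *)
Lemma gaussian_is_derive i x s :
  is_derive x (e_ i) (v ^~ s : _ -> R^o) (gu x s ord0 i).
Proof.
have := is_derive_sqr_dual N_gt0 normH sconvH x (e_ i).
set q := fun y => _; rewrite dotmulC dotmul_delta => dq.
have dbq := is_deriveZ (Lambda / lam s) dq.
have dexp := is_derive_comp_real dbq (is_derive_expR _).
have := is_deriveZ (lam s `^ (- (N%:R / 2))) dexp.
rewrite (_ : _ \*: _ = v ^~ s); last first.
  apply/funext => y; rewrite -[LHS]/(_ * expR (Lambda / lam s * H0 y ^+ 2)).
  by congr (_ * expR _); rewrite mulrAC.
move=> /is_derive_eq; apply.
rewrite -[LHS]/(lam s `^ (- (N%:R / 2)) * (expR (Lambda / lam s * q x) *
  (Lambda / lam s * (2 * legendre H x ord0 i)))).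
rewrite /gu /gaussian_grad mxE /gaussian -/(q x) [Lambda * q x / _]mulrAC; ring.
Qed.

Let is_derive_lam (s : R) : is_derive s 1 (fun s : R => lam s) (- (4 * Lambda)).
Proof.
have := is_deriveB (is_derive_cst (1 : R) s 1) (is_deriveZ (4 * Lambda) (is_derive_id s 1)).
by move=> /is_derive_eq; apply; rewrite sub0r [_ *: _]mulr1.
Qed.

Lemma gaussian_is_derive_t x s : s < T ->
  is_derive s 1 (v x) (gaussian_dt x s).
Proof.
move=> sT; have ls := lam_gt0 sT; have ls0 : lam s != 0 by rewrite gt_eqF.
have dl := is_derive_lam s.
have dV : is_derive s 1 (fun s : R => (lam s)^-1) (4 * Lambda / lam s ^+ 2).
  have := is_derive_inv_real (f := fun s : R => lam s) ls0 dl.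
  by move=> /is_derive_eq; apply; rewrite mulrNN mulrC.
have dln : is_derive s 1 (fun s : R => ln (lam s)) ((lam s)^-1 * - (4 * Lambda)).
  by apply: (@is_derive1_comp _ (@ln R)); exact: is_derive1_ln.
have dE := is_deriveB (is_deriveZ (Lambda * H0 x ^+ 2) dV) (is_deriveZ (N%:R / 2) dln).
have dexp := is_derive1_comp (is_derive_expR _) dE.
have E : \forall r \near s, (expR \o ((Lambda * H0 x ^+ 2 \*: (fun s : R => (lam s)^-1))
    - (N%:R / 2 \*: (fun s : R => ln (lam s))))) r = v x r.
  have := lt_nbhsl sT; apply: filterS => r rT.
  by rewrite (gaussianE _ rT).
apply: DeriveDef.
  by apply: (near_eq_derivable E); exact: ex_derive.
rewrite -(near_eq_derive _ E) derive_val.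
rewrite -[LHS]/(expR (Lambda * H0 x ^+ 2 / lam s - N%:R / 2 * ln (lam s)) *
  (Lambda * H0 x ^+ 2 * (4 * Lambda / lam s ^+ 2) -
   N%:R / 2 * ((lam s)^-1 * - (4 * Lambda)))).
rewrite -(gaussianE _ sT) /gaussian_dt /gaussian_grad dotmulZr.
(* Euler's identity turns x.grad v into (2 Lambda / lam) v H0^2, which matches the derivative of the
   exponent. *)
rewrite (dotmul_legendre N_gt0 normH) -/(v x s).
by field.
Qed.

Lemma gaussian_flux x s : s < T ->
  finsler_flux H (gu x s) = (2 * Lambda / lam s * v x s) *: x.
Proof.
move=> sT; apply: (finsler_flux_legendre N_gt0 normH).
by rewrite mulr_gt0 ?gaussian_gt0// divr_gt0 ?mulr_gt0 ?lam_gt0.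
Qed.

Lemma gaussian_continuous_x s : continuous (v ^~ s).
Proof.
move=> x; have FF : Filter (nbhs x) := nbhs_filter x.
apply: cvgM; first exact: cvg_cst.
apply: (@cvg_comp _ _ _ _ expR _ (nbhs (Lambda * H0 x ^+ 2 / lam s)));
  last exact: continuous_expR.
apply: cvgM; last exact: cvg_cst.
by apply: cvgM; [exact: cvg_cst|exact: sqr_continuous].
Qed.

Lemma gaussian_grad_continuous_x s i : continuous (fun x => gu x s ord0 i).
Proof.
move=> x; have FF : Filter (nbhs x) := nbhs_filter x.
suff : 2 * Lambda / lam s * v y s * legendre H y ord0 i
    @[y --> x] --> 2 * Lambda / lam s * v x s * legendre H x ord0 i.
  rewrite (_ : _ * _ * legendre H x ord0 i = gu x s ord0 i); last by rewrite mxE.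
  by apply: cvg_trans; apply: near_eq_cvg; apply: nearW => z; rewrite mxE.
apply: cvgM; first by apply: cvgM; [exact: cvg_cst|exact: gaussian_continuous_x].
apply: (@cvg_comp _ _ _ _ (fun z : 'rV[R]_N => z ord0 i) _ (nbhs (legendre H x))).
  exact: (legendre_continuous N_gt0 normH sconvH).
exact: coord_continuous.
Qed.

Lemma measurable_gaussian :
  measurable_fun (setT `*` `]0, T[) (fun z : 'rV[R]_N * R => v z.1 z.2).
Proof.
have mlam (p : R) : measurable_fun setT (fun z : 'rV[R]_N * R => lam z.2 `^ p).
  have m1 : measurable_fun setT (fun s : R => lam s `^ p).
    apply: (measurableT_comp (@measurable_powR R p)).
    exact: continuous_measurable_fun.
  exact: (measurableT_comp m1 measurable_snd).
(* The inverse of lam is written as a power -1, measurable in its base on the whole line; the two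
   agree where lam is nonnegative. *)
have mE : measurable_fun setT (fun z : 'rV[R]_N * R =>
    lam z.2 `^ (- (N%:R / 2)) * expR (Lambda * H0 z.1 ^+ 2 * lam z.2 `^ (- 1))).
  apply: measurable_funM; first exact: mlam.
  apply: measurableT_comp; first exact: measurable_expR.
  apply: measurable_funM; last exact: mlam.
  have m2 : measurable_fun setT (fun x : 'rV[R]_N => Lambda * H0 x ^+ 2).
    apply: continuous_measurable_rV => x; have FF : Filter (nbhs x) := nbhs_filter x.
    by apply: cvgM; [exact: cvg_cst|exact: sqr_continuous].
  exact: (measurableT_comp m2 measurable_fst).
apply: (eq_measurable_fun _ _ (measurable_funTS mE)) => -[x s] /set_mem [_ /=].
by rewrite in_itv/= => /andP[_ sT]; rewrite powR_inv1 ?ltW ?lam_gt0//.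
Qed.

Lemma gaussian_min t x : t < T -> v 0 t <= v x t.
Proof.
move=> tT; rewrite ler_wpM2l ?powR_ge0// ler_expR dual_norm0//.
rewrite expr0n /= mulr0 mul0r divr_ge0//; last by rewrite ltW// lam_gt0.
by rewrite mulr_ge0 ?sqr_ge0// ltW.
Qed.

Lemma gaussian_blowup : v 0 t @[t --> T^'-] --> +oo.
Proof.
apply/cvgryPge => A.
(* Chosen so that t > T - d forces lam t < 4 Lambda d = exp(-|A| / (N/2)); then -(N/2) ln(lam t) >=
   |A|, and exp(u) >= 1 + u concludes. *)
pose d : R := expR (- (`|A| / (N%:R / 2))) / (4 * Lambda).
have L4 : 0 < 4 * Lambda by rewrite mulr_gt0.
have N2 : 0 < N%:R / 2 :> R by rewrite divr_gt0// ltr0n.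
have d0 : 0 < d by rewrite divr_gt0// expR_gt0.
have lT : T - d < T by rewrite gtrBl.
have lT' : \forall t \near T^'-, T - d < t /\ t < T.
  near=> t; split; first by near: t; exact: nbhs_left_gt.
  by near: t; exact: nbhs_left_lt.
apply: filterS lT' => t [dt tT].
rewrite (gaussianE _ tT) dual_norm0// expr0n /= mulr0 mul0r sub0r.
have ll : ln (lam t) <= - (`|A| / (N%:R / 2)).
  rewrite -[leRHS]expRK ler_ln ?posrE ?expR_gt0 ?lam_gt0//.
  have := ltW dt; rewrite lerBlDr -(ler_pM2l L4) divff ?gt_eqF// mulrDr.
  by rewrite /d mulrC [4 * Lambda * (_ / _)]mulrC divfK ?gt_eqF//; lra.
apply: (le_trans (ler_norm A)).
apply: (le_trans _ (expR_ge1Dx _)).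
have : `|A| <= - (N%:R / 2 * ln (lam t)).
  rewrite -mulrN -ler_pdivrMl// mulrC lerNr.
  by rewrite (le_trans ll)// lerNl opprK.
by lra.
Unshelve. all: by end_near.
Qed.

End gaussian.

(** * The weak formulation *)

Section slices.
Context {R : realType} {n : nat}.
Implicit Types (f : 'rV[R]_n * R -> R) (y : 'rV[R]_n) (s : R).

Lemma continuous_slice1 f y s : {for (y, s), continuous f} ->
  {for y, continuous (fun x => f (x, s))}.
Proof.
have Fy : Filter (nbhs y) := nbhs_filter y.
have Fs : Filter (nbhs s) := nbhs_filter s.
move=> cf; apply: (@cvg_comp _ _ _ (fun x => (x, s)) f _ (nbhs (y, s))); last exact: cf.
exact: (@cvg_pair _ _ _ (nbhs y) (nbhs y) (nbhs s) Fy Fy Fs id (cst s) cvg_id (cvg_cst s)).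
Qed.

Lemma continuous_slice2 f y s : {for (y, s), continuous f} ->
  {for s, continuous (fun r => f (y, r))}.
Proof.
have Fy : Filter (nbhs y) := nbhs_filter y.
have Fs : Filter (nbhs s) := nbhs_filter s.
move=> cf; apply: (@cvg_comp _ _ _ (fun r => (y, r)) f _ (nbhs (y, s))); last exact: cf.
exact: (@cvg_pair _ _ _ (nbhs s) (nbhs y) (nbhs s) Fs Fy Fs (cst y) id (cvg_cst y) cvg_id).
Qed.

Variables (phi : 'rV[R]_n * R -> R).
Hypothesis sphi : smooth phi.

Lemma smooth_continuous : continuous phi.
Proof. exact: (sphi 0). Qed.

Lemma smooth_derive_continuous w : continuous (fun z => 'D_w (phi : _ -> R^o) z).
Proof. by have [_] := sphi 1; exact. Qed.

Let smooth_is_derive z w : is_derive z w (phi : _ -> R^o) ('D_w (phi : _ -> R^o) z).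
Proof. by have [/(_ z) dphi _] := sphi 1; apply: DeriveDef => //; exact: diff_derivable. Qed.

Lemma smooth_is_derive_space y s (w : 'rV[R]_n) :
  is_derive y w (fun x => phi (x, s) : R^o) ('D_((w, 0) : 'rV[R]_n * R) (phi : _ -> R^o) (y, s)).
Proof.
apply: cvg_is_derive; apply: cvg_trans (is_derive_cvg (smooth_is_derive (y, s) (w, 0))).
apply: near_eq_cvg; apply: nearW => h.
by rewrite (_ : h *: _ + _ = (h *: w + y, s))//; congr pair; rewrite /= scaler0 add0r.
Qed.

Lemma smooth_is_derive_time y s :
  is_derive s 1 (fun r => phi (y, r) : R^o)
    ('D_((0, 1) : 'rV[R]_n * R) (phi : _ -> R^o) (y, s)).
Proof.
apply: cvg_is_derive; apply: cvg_trans (is_derive_cvg (smooth_is_derive (y, s) (0, 1))).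
apply: near_eq_cvg; apply: nearW => h.
by rewrite (_ : h *: _ + _ = (y, h *: 1 + s))//; congr pair; rewrite /= scaler0 add0r.
Qed.

End slices.

(** * Integrals against the initial measure when its density is nonnegative *)

Section radon_density.
Context {R : realType} {n : nat}.
Variables (f : 'rV[R]_n -> R) (lf : locally_integrable_rV f).
Hypothesis f0 : forall x, 0 <= f x.

Let neg0 A : radon_neg (radon_of_density lf) A = 0%E.
Proof.
rewrite /= /pos_density integral0_eq// => y _.
by rewrite (@max_r _ _ (- f y) 0)// oppr_le0.
Qed.

Let integral_neg D (h : 'rV[R]_n -> \bar R) :
  (\int[radon_neg (radon_of_density lf)]_(x in D) h x = 0)%E.
Proof.
rewrite (eq_measure_integral mzero) ?integral_measure_zero// => A _ _.
exact: neg0.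
Qed.

Lemma radon_integral_density (h : 'rV[R]_n -> R) : measurable_fun setT h ->
  radon_integral (radon_of_density lf) h = \int[lebesgue_rV R n]_y (h y * f y).
Proof.
move=> mh; rewrite /radon_integral [X in _ - X]/Rintegral integral_neg subr0.
exact: integral_pos_density.
Qed.

Lemma integral_radon_variation_density D (h : 'rV[R]_n -> R) : measurable D ->
  measurable_fun D h -> (forall x, 0 <= h x) ->
  (\int[radon_variation (radon_of_density lf)]_(x in D) (h x)%:E =
   \int[lebesgue_rV R n]_(x in D) (h x * f x)%:E)%E.
Proof.
move=> mD mh h0; rewrite ge0_integral_measure_add//; first last.
- exact/measurable_EFinP.
- by move=> x _; rewrite lee_fin.
rewrite integral_neg adde0 integral_mkcond [RHS]integral_mkcond.
rewrite ge0_integral_pos_density//.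
- apply: eq_integral => x _; rewrite !patchE; case: ifP => _; last by rewrite mul0e.
  by rewrite (max_l (f0 x)) EFinM.
- by apply/(measurable_restrictT _ mD); exact/measurable_EFinP.
- by move=> x; rewrite patchE; case: ifP => // _; rewrite lee_fin.
Qed.

End radon_density.

(** * The weak identity for one test function *)

Section weak_formulation.
Context {R : realType} {N : nat}.
Variables (H : 'rV[R]_N -> R) (Lambda : R).
Hypotheses (N_gt0 : (0 < N)%N) (normH : finsler_norm H).
Hypothesis sconvH : strictly_convex_set [set xi | H xi < 1].
Hypothesis Lambda_gt0 : 0 < Lambda.
Local Notation leb := (lebesgue_rV R N).
Local Notation T := (4 * Lambda)^-1.
Local Notation lam s := (1 - 4 * Lambda * s).
Local Notation e_ i := (delta_mx ord0 i).
Local Notation v := (gaussian H Lambda).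
Local Notation gu := (gaussian_grad H Lambda).
Local Notation vt := (gaussian_dt H Lambda).

Variable phi : 'rV[R]_N * R -> R.
Hypothesis sphi : smooth phi.
Variable M : R.
Hypothesis phi0 : forall y s, 0 <= s < T -> M < `|y| -> phi (y, s) = 0.

Local Notation phit := (fun z => 'D_((0, 1) : 'rV[R]_N * R) (phi : _ -> R^o) z).
Local Notation phii i := (fun z => 'D_((e_ i, 0) : 'rV[R]_N * R) (phi : _ -> R^o) z).
Local Notation box := [set y : 'rV[R]_N | `|y| <= M].

(** Minus the time derivative of v phi: what is left of the weak integrand once a spatial divergence
    has been removed. *)
Definition gaussian_test_dt (z : 'rV[R]_N * R) : R :=
  - (vt z.1 z.2 * phi z + v z.1 z.2 * phit z).
Local Notation k := gaussian_test_dt.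

(** [phi0] says nothing at negative times, so a neighbourhood of s has to avoid them: hence 0 < s
    here, against 0 <= s for the spatial derivatives. *)
Let phit0 y s : 0 < s < T -> M < `|y| -> phit (y, s) = 0.
Proof.
move=> /andP[s0 sT] My; apply: (is_derive_eq0_near (smooth_is_derive_time sphi y s)).
apply: filterS2 (lt_nbhsr s0) (lt_nbhsl sT) => r r0 rT.
by apply: phi0 => //; rewrite ltW.
Qed.

Let phii0 i y s : 0 <= s < T -> M < `|y| -> phii i (y, s) = 0.
Proof.
move=> sT My; apply: (is_derive_eq0_near (smooth_is_derive_space sphi y s (e_ i))).
have : \forall x \near y, M < `|x| by exact: (cvgr_gt _ (@norm_continuous _ _ y)).
by apply: filterS => x; exact: phi0.
Qed.

Let k_continuous (y : 'rV[R]_N) (s : R) : s < T -> {for (y, s), continuous k}.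
Proof.
move=> sT; apply: cvgN; apply: cvgD; apply: cvgM.
- exact: gaussian_dt_continuous.
- exact: smooth_continuous.
- exact: gaussian_continuous.
- exact: smooth_derive_continuous.
Qed.

Let k0 y s : 0 < s < T -> M < `|y| -> k (y, s) = 0.
Proof.
move=> sT My; have /andP[s0 sT'] := sT.
by rewrite /k phi0 ?ltW// phit0// !mulr0 addr0 oppr0.
Qed.

(* The two integrands differ by the divergence of (2 Lambda / lam) v phi y. *)
Lemma gaussian_inner s : 0 < s < T ->
  \int[leb]_y (- v y s * derive1 (fun r => phi (y, r) : R^o) s +
    dotmul (finsler_flux H (gu y s)) (grad (fun z => phi (z, s)) y)) =
  \int[leb]_(y in box) k (y, s).
Proof.
move=> s0T; have /andP[s0 sT] := s0T; have s0T' : 0 <= s < T by rewrite ltW.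
pose c := 2 * Lambda / lam s.
pose g i (y : 'rV[R]_N) := c * (v y s * y ord0 i) * phi (y, s).
pose dg i (y : 'rV[R]_N) := c * (v y s * y ord0 i) * phii i (y, s) +
  c * (v y s + y ord0 i * gu y s ord0 i) * phi (y, s).
have cv := @gaussian_continuous_x _ _ _ Lambda N_gt0 normH s.
have cg := @gaussian_grad_continuous_x _ _ _ Lambda N_gt0 normH sconvH s.
have cphi : continuous (fun y => phi (y, s)).
  by move=> y; apply: continuous_slice1; exact: smooth_continuous.
have cphii i : continuous (fun y => phii i (y, s)).
  by move=> y; apply: (@continuous_slice1 _ _ (phii i)); exact: smooth_derive_continuous.
have cc i : continuous (fun y : 'rV[R]_N => y ord0 i) by exact: coord_continuous.
have cdg i : continuous (dg i).
  move=> y; have FF : Filter (nbhs y) := nbhs_filter y.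
  apply: cvgD; apply: cvgM; [|exact: cphii| |exact: cphi].
    by apply: cvgM; [exact: cvg_cst|apply: cvgM; [exact: cv|exact: cc]].
  apply: cvgM; first exact: cvg_cst.
  by apply: cvgD; [exact: cv|apply: cvgM; [exact: cc|exact: cg]].
have g0 i y : M < `|y| -> g i y = 0 by move=> My; rewrite /g phi0// mulr0.
have dg0 i y : M < `|y| -> dg i y = 0.
  by move=> My; rewrite /dg phi0// phii0// !mulr0 addr0.
have gdg i y : is_derive y (e_ i) (g i : _ -> R^o) (dg i y).
  have dcoord : is_derive y (e_ i) ((fun x : 'rV[R]_N => x ord0 i) : _ -> R^o) 1.
    apply: cvg_is_derive.
    apply: (@cvg_trans _ ((fun=> 1 : R) @ (0 : R)^')); last exact: cvg_cst.
    apply: near_eq_cvg; apply: filterS (nbhs_dnbhs_neq (0 : R)) => h h0.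
    by rewrite !mxE !eqxx mulr1 addrK mulVf.
  have d1 := is_deriveM (gaussian_is_derive Lambda N_gt0 normH sconvH i y s) dcoord.
  have d2 := is_deriveM (is_deriveZ c d1) (smooth_is_derive_space sphi y s (e_ i)).
  apply: (is_derive_eq d2).
  rewrite -[LHS]/(c * (v y s * y ord0 i) * phii i (y, s) +
    phi (y, s) * (c * (v y s * 1 + y ord0 i * gu y s ord0 i))) /dg; ring.
have div0 := Rintegral_divergence_supp cdg gdg g0 dg0.
have ck : continuous (fun y => k (y, s)).
  by move=> y; exact: (continuous_slice1 (@k_continuous y s sT)).
have k0' y : M < `|y| -> k (y, s) = 0 by exact: k0.
have csum : continuous (fun y => \sum_(i < N) dg i y).
  move=> y; have FF : Filter (nbhs y) := nbhs_filter y.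
  by apply: cvg_big => [p|i _]; [exact: add_continuous|exact: cdg].
have sum0 y : M < `|y| -> \sum_(i < N) dg i y = 0.
  by move=> My; apply: big1 => i _; exact: dg0.
have isum := continuous_integrable_supp csum sum0.
have ik := continuous_integrable_supp ck k0'.
transitivity (\int[leb]_y (\sum_(i < N) dg i y + k (y, s))); last first.
  rewrite RintegralD// div0 add0r [RHS]Rintegral_mkcond.
  apply: eq_Rintegral => y _; rewrite patchE.
  by case: ifPn => //; rewrite notin_setE /= => /negP; rewrite -ltNge => /k0'.
apply: eq_Rintegral => y _.
rewrite derive1E (@derive_val _ _ _ _ _ _ _ (smooth_is_derive_time sphi y s)).
rewrite (gaussian_flux N_gt0 normH Lambda_gt0)// dotmulZl.
(* The terms in which [phi] is not differentiated add up to the divergence of the flux times [phi],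
   and that divergence is how [gaussian_dt] is defined. *)
have -> : \sum_(i < N) dg i y = c * v y s * dotmul y (grad (fun z => phi (z, s)) y)
    + vt y s * phi (y, s).
  rewrite big_split /=; congr (_ + _).
    rewrite /dotmul mulr_sumr; apply: eq_bigr => i _; rewrite mxE.
    rewrite (@derive_val _ _ _ _ _ _ _ (smooth_is_derive_space sphi y s (e_ i))).
    by rewrite !mulrA.
  rewrite -mulr_suml -mulr_sumr big_split /= /gaussian_dt; congr (_ * (_ + _) * _).
  by rewrite sumr_const card_ord mulr_natl.
by rewrite /c /k /=; ring.
Qed.

Let k_measurable t : t < T -> measurable_fun (box `*` `]0, t[) k.
Proof.
(* Freezing the time variable beyond [t] makes the integrand globally continuous. *)
move=> tT; pose kt (z : 'rV[R]_N * R) := k (z.1, Num.min z.2 t).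
have ckt : continuous kt.
  move=> [y s].
  have mT : Num.min s t < T by rewrite gt_min tT orbT.
  apply: (@cvg_comp _ _ _ (fun z : 'rV[R]_N * R => (z.1, Num.min z.2 t))
    k _ (nbhs (y, Num.min s t))); last exact: (@k_continuous y _ mT).
  have c1 : z.1 @[z --> ((y, s) : 'rV[R]_N * R)] --> y by exact: cvg_fst.
  have c2 : Num.min z.2 t @[z --> ((y, s) : 'rV[R]_N * R)] --> Num.min s t.
    apply: (@cvg_comp _ _ _ snd (fun s => Num.min s t) _ (nbhs s)); first exact: cvg_snd.
    have -> : (fun s => Num.min s t) = (fun s => (s + t - `|s - t|) / 2).
      by apply/funext => r; rewrite minr_absE.
    rewrite minr_absE; apply: cvgM; last exact: cvg_cst.
    apply: cvgB; first by apply: cvgD; [exact: cvg_id|exact: cvg_cst].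
    by apply: cvg_norm; apply: cvgB; [exact: cvg_id|exact: cvg_cst].
  exact: (cvg_pair c1 c2).
apply: (eq_measurable_fun _ _ (measurable_funTS (continuous_measurable_rV_prod ckt))).
by move=> -[y s] /set_mem [_ /=]; rewrite in_itv/= => /andP[_ st]; rewrite /kt /= min_l// ltW.
Qed.

(** Compactness of the box times [0, t], on which [k] is continuous because t < T; the constant is
    the bound that Fubini asks for. *)
Let k_bounded t : t < T -> exists C : R,
  forall y s, box y -> (`]0, t[%classic : set R) s -> `|k (y, s)| <= C.
Proof.
move=> tT.
have [|C _ kC] := @bounded_on_compact _ _ (box `*` `[0, t]) k
  (compact_setX (@compact_closed_box _ _ M) (@segment_compact _ 0 t)).
  move=> [y s] [_ /=]; rewrite in_itv/= => /andP[_ st].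
  exact/k_continuous/(le_lt_trans st).
exists C => y s By; rewrite /= in_itv/= => /andP[s0 st].
by apply: (kC (y, s)); split => //=; rewrite in_itv/= !ltW.
Qed.

Let k_FTC t y : 0 < t < T ->
  \int[lebesgue_measure]_(s in `]0, t[) k (y, s) = v y 0 * phi (y, 0) - v y t * phi (y, t).
Proof.
move=> /andP[t0 tT].
pose F s := - (v y s * phi (y, s)).
have dF s : s < T -> is_derive s 1 F (k (y, s)).
  move=> sT; have d1 := is_deriveN (is_deriveM
    (gaussian_is_derive_t N_gt0 normH Lambda_gt0 y sT) (smooth_is_derive_time sphi y s)).
  apply: (is_derive_eq d1); congr (- _); rewrite addrC; congr (_ + _).
  exact: mulrC.
have ck s : s < T -> {for s, continuous (fun s => k (y, s))}.
  by move=> sT; exact: (continuous_slice2 (@k_continuous y s sT)).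
have cF s : s < T -> {for s, continuous F}.
  move=> sT; apply: differentiable_continuous; apply/derivable1_diffP.
  exact: (@ex_derive _ _ _ _ _ _ _ (dF s sT)).
have ckw : {within `[0, t], continuous (fun s => k (y, s))}.
  apply: continuous_in_subspaceT => s /set_mem /=; rewrite in_itv/= => /andP[_ st].
  exact/ck/(le_lt_trans st).
have ki : (@lebesgue_measure R).-integrable `[0, t] (EFin \o (fun s => k (y, s))).
  exact: continuous_compact_integrable (@segment_compact _ 0 t) ckw.
(* Endpoints are null, and the fundamental theorem is applied on the closed interval. *)
rewrite Rintegral_itv_bndo_bndc; last first.
  by apply: integrableS ki => //; apply: subset_itv; rewrite bnd_simp.
rewrite Rintegral_itv_obnd_cbnd; last first.
  by apply: integrableS ki => //; apply: subset_itv; rewrite bnd_simp.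
rewrite /Rintegral (@continuous_FTC2 _ _ F)//.
- by rewrite -EFinB /= /F opprK addrC.
- split.
  + move=> s; rewrite in_itv/= => /andP[_ st].
    exact: (@ex_derive _ _ _ _ _ _ _ (dF s (lt_trans st tT))).
  + by apply/cvg_at_right_filter/cF; rewrite (lt_trans t0).
  + exact/cvg_at_left_filter/cF.
- move=> s; rewrite in_itv/= => /andP[_ st].
  by rewrite derive1E (@derive_val _ _ _ _ _ _ _ (dF s (lt_trans st tT))).
Qed.

(** Once the inner integrals live on the bounded box, the order of integration can be exchanged; for
    each y the time integral is v phi at 0 minus v phi at t, and the latter cancels the first
    term. *)
Lemma gaussian_weak_identity t : 0 < t < T ->
  \int[leb]_y (v y t * phi (y, t)) +
  \int[lebesgue_measure]_(s in `]0, t[) \int[leb]_y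
    (- v y s * derive1 (fun r => phi (y, r) : R^o) s +
     dotmul (finsler_flux H (gu y s)) (grad (fun z => phi (z, s)) y)) =
  \int[leb]_y (phi (y, 0) * v y 0).
Proof.
move=> t0T; have /andP[t0 tT] := t0T.
have mB := @measurable_closed_box R N M.
have Bfin : (leb box < +oo)%E by exact: (lebesgue_bounded_fin mB (fun y yM => yM)).
have itvfin : (@lebesgue_measure R `]0%R, t[%classic < +oo)%E.
  by rewrite lebesgue_measure_itv /= lte_fin t0 -EFinB ltry.
have [C kC] := k_bounded tT.
have ivphi s : 0 <= s < T -> leb.-integrable box (EFin \o (fun y => v y s * phi (y, s))).
  move=> sT; apply: (continuous_integrable_bounded mB (fun y yM => yM)) => y.
  have FF : Filter (nbhs y) := nbhs_filter y.
  apply: cvgM; first exact: (@gaussian_continuous_x _ _ _ Lambda N_gt0 normH s).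
  by apply: continuous_slice1; exact: smooth_continuous.
have toB (g : 'rV[R]_N -> R) : (forall y, M < `|y| -> g y = 0) ->
    \int[leb]_y g y = \int[leb]_(y in box) g y.
  move=> g0; rewrite [RHS]Rintegral_mkcond; apply: eq_Rintegral => y _; rewrite patchE.
  by case: ifPn => //; rewrite notin_setE /= => /negP; rewrite -ltNge => /g0.
have -> : \int[lebesgue_measure]_(s in `]0, t[) \int[leb]_y
    (- v y s * derive1 (fun r => phi (y, r) : R^o) s +
     dotmul (finsler_flux H (gu y s)) (grad (fun z => phi (z, s)) y)) =
    \int[lebesgue_measure]_(s in `]0, t[) \int[leb]_(y in box) k (y, s).
  apply: eq_Rintegral => s /set_mem /=; rewrite in_itv/= => /andP[s0 st].
  by apply: gaussian_inner; rewrite s0 (lt_trans st).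
have := @Rintegral_exchange_bounded R _ _ _ _ leb (@lebesgue_measure R) box `]0, t[%classic
  k C mB (measurable_itv _) Bfin itvfin (k_measurable tT) kC.
move=> <-.
rewrite [X in _ + X](_ : _ = \int[leb]_(y in box) (v y 0 * phi (y, 0) - v y t * phi (y, t)));
  last by apply: eq_Rintegral => y _; exact: k_FTC.
have T0 : 0 <= (0 : R) < T by rewrite lexx (lt_trans t0).
have Tt : 0 <= t < T by rewrite ltW.
rewrite RintegralB//; [|exact: ivphi|exact: ivphi].
rewrite (toB (fun y => v y t * _)) => [|y My]; last by rewrite phi0// mulr0.
rewrite (toB (fun y => _ * v y 0)) => [|y My]; last by rewrite phi0// mul0r.
rewrite addrC subrK; apply: eq_Rintegral => y _; exact: mulrC.
Qed.

End weak_formulation.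

(** * Regularity in time and conclusion *)

Section nonneg_integral.
Context {d} {T : measurableType d} {R : realType} (m : {measure set T -> \bar R}).

(* Unlike [ge0_le_integral], no measurability of the smaller function. *)
Lemma le_integral_nonneg (D : set T) (f g : T -> \bar R) :
  (forall x, D x -> (0 <= f x <= g x)%E) ->
  (\int[m]_(x in D) f x <= \int[m]_(x in D) g x)%E.
Proof.
move=> fg; rewrite integral_mkcond [leRHS]integral_mkcond.
have fg' x : (0 <= (f \_ D) x <= (g \_ D) x)%E.
  by rewrite !patchE; case: ifPn => [/set_mem/fg//|_]; rewrite lexx.
rewrite !ge0_integralTE => [|x|x].
- apply: ereal_sup_le => _ /= [h hf <-]; exists h => // x.
  by apply: (le_trans (hf x)); case/andP: (fg' x).
- by case/andP: (fg' x) => /le_trans; apply.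
- by case/andP: (fg' x).
Qed.

End nonneg_integral.

(** * Bochner integrability of continuous bounded curves *)

Section step_approximation.
Context {R : realType} {V : zmodType}.
Variables (X : set V) (nX : V -> \bar R) (w : R -> V) (S : R).

(** Rounds t down to the grid of mesh 1/(k+1), so that [w \o step k] is constant on each grid
    cell. *)
Let step k (t : R) := (Num.truncn (t * k.+1%:R))%:R / k.+1%:R : R.

Let step_simple k : (forall t, X (w t)) -> simple_valued `]0, S[ X (w \o step k).
Proof.
move=> Xw; split; first by move=> t _; exact: Xw.
- pose F (j : nat) := w (j%:R / k.+1%:R).
  apply: (@sub_finite_set _ _ (F @` `I_(Num.truncn (S * k.+1%:R)).+1)).
    move=> _ [t tS <-]; move: tS; rewrite /= in_itv/= => /andP[t0 tS].
    exists (Num.truncn (t * k.+1%:R)) => //=; rewrite ltnS.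
    by apply: le_truncn; rewrite ler_wpM2r// ltW.
  by apply: finite_image; exact: finite_II.
- move=> a.
  (* Several cells may carry the same value, so the fibre is the union of all cells on which it is
     taken. *)
  have -> : `]0, S[ `&` (w \o step k) @^-1` [set a] =
    \bigcup_(j in [set j : nat | w (j%:R / k.+1%:R) = a])
      (`]0, S[ `&` `[j%:R / k.+1%:R, j.+1%:R / k.+1%:R[).
    have k0 : (0 : R) < k.+1%:R by rewrite ltr0n.
    have stepP (t : R) j : 0 < t ->
        (j%:R / k.+1%:R <= t < j.+1%:R / k.+1%:R) = (Num.truncn (t * k.+1%:R) == j).
      move=> t0; rewrite ler_pdivrMr// ltr_pdivlMr//.
      by rewrite -truncn_eq// mulr_ge0// ltW.
    apply/seteqP; split=> t.
      move=> [tS <-]; exists (Num.truncn (t * k.+1%:R)) => //; split => //.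
      move: tS; rewrite /= !in_itv/= => /andP[t0 _].
      by rewrite stepP.
    move=> [j /= wj [tS]]; move: (tS); rewrite /= !in_itv/= => /andP[t0 _].
    by rewrite stepP// => /eqP tj; split => //; rewrite /step tj.
  rewrite bigcup_mkcond; apply: bigcupT_measurable => j.
  case: ifP => _ //; apply: measurableI; exact: measurable_itv.
Qed.

Let step_cvg t : 0 <= t -> step k t @[k --> \oo] --> t.
Proof.
move=> t0; apply/cvgrPdist_le => e e0.
have [k0 _ kP] := (@cvgrPdist_lt R R _ _ _ _ _).1 (@cvg_harmonic R) e e0.
exists k0 => // k /= /kP; rewrite sub0r normrN /harmonic /= ger0_norm ?invr_ge0// => ke.
have K0 : (0 : R) < k.+1%:R by rewrite ltr0n.
have := truncn_itv (mulr_ge0 t0 (ltW K0)) => /andP[].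
rewrite -ler_pdivrMr// -ltr_pdivlMr// -/(step k t) => st1 st2.
rewrite ger0_norm ?subr_ge0//; apply: le_trans (ltW ke).
rewrite lerBlDl; apply: (le_trans (ltW st2)).
by rewrite /step -[_.+1%:R]natr1 mulrDl mul1r.
Qed.

(** The simple functions sample [w] at grid points at or before t, and continuity for [nX] gives
    convergence at every t. The grid point 0 lies outside ]0, S[, so membership in [X] is asked
    beyond the interval. *)
Lemma bochner_L1_continuous (C : R) :
  (forall t, X (w t)) ->
  (forall t, 0 < t < S -> nX (w s - w t) @[s --> t] --> 0%E) ->
  (forall t, 0 < t < S -> (0 <= nX (w t) <= C%:E)%E) ->
  bochner_L1 `]0, S[ X nX w.
Proof.
move=> Xw cw wC; split.
- by apply: aeW.
- exists (fun k => w \o step k); split; first by move=> k; exact: step_simple.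
  apply: aeW => t /=; rewrite in_itv/= => t0S; have /andP[t0 tS] := t0S.
  apply: (@cvg_comp _ _ _ (step ^~ t) (fun s => nX (w s - w t)) _ (nbhs t)).
    exact/step_cvg/ltW.
  exact: cw.
- apply: (@le_lt_trans _ _ (\int[lebesgue_measure]_(t in `]0%R, S[) C%:E)%E).
    by apply: le_integral_nonneg => t /=; rewrite in_itv/= => /wC.
  rewrite integral_cst//.
  apply: (@le_lt_trans _ _ (C%:E * @lebesgue_measure R `]0%R, S[%classic)%E) => //.
  rewrite lebesgue_measure_itv /= lte_fin.
  by case: ifP => _; [rewrite -EFinD -EFinM ltry|rewrite mule0].
Qed.

End step_approximation.

(** * Regularity of the solution and mass of its initial data *)

Section solution.
Context {R : realType} {N : nat}.
Variables (H : 'rV[R]_N -> R) (Lambda : R).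
Hypotheses (N_gt0 : (0 < N)%N) (normH : finsler_norm H).
Hypothesis sconvH : strictly_convex_set [set xi | H xi < 1].
Hypothesis Lambda_gt0 : 0 < Lambda.
Local Notation leb := (lebesgue_rV R N).
Local Notation H0 := (dual_norm H).
Local Notation T := (4 * Lambda)^-1.
Local Notation lam s := (1 - 4 * Lambda * s).
Local Notation e_ i := (delta_mx ord0 i).
Local Notation v := (gaussian H Lambda).
Local Notation gu := (gaussian_grad H Lambda).

Lemma measurable_dual_ball x r : measurable (dual_ball H x r).
Proof.
apply: measurable_lt_continuous_rV => y; have FF : Filter (nbhs y) := nbhs_filter y.
apply: (@cvg_comp _ _ _ (fun y => y - x) H0 _ (nbhs (y - x))).
  by apply: cvgB; [exact: cvg_id|exact: cvg_cst].
exact: dual_norm_continuous.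
Qed.

Lemma dual_ball_bounded r : exists M, forall y, dual_ball H 0 r y -> `|y| <= M.
Proof.
have [C C0 HC] := norm_le_dual N_gt0 normH; exists (C * r) => y.
rewrite /dual_ball /= subr0 => /ltW yr; apply: (le_trans (HC y)).
by rewrite ler_wpM2l// ltW.
Qed.

(** The classical gradient is continuous and [psi] vanishes off a compact subset of the ball, so
    integrals over the ball are integrals over the whole space, where integration by parts has no
    boundary term. *)
Lemma gaussian_W11 r s : W11 (dual_ball H 0 r) (v ^~ s, gu ^~ s).
Proof.
have [M DM] := dual_ball_bounded r; have mD := measurable_dual_ball 0 r.
have cv := @gaussian_continuous_x _ _ _ Lambda N_gt0 normH s.
have cg := @gaussian_grad_continuous_x _ _ _ Lambda N_gt0 normH sconvH s.
split => /=.
- exact: continuous_integrable_bounded mD DM cv.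
- by move=> i; exact: continuous_integrable_bounded mD DM (cg i).
- move=> psi [spsi [K [cK KD] psi0]] i.
  have KM y : M < `|y| -> ~ K y.
    by move=> My /KD/DM; rewrite leNgt My.
  have dpsi x : is_derive x (e_ i) (psi : _ -> R^o) ('D_(e_ i) (psi : _ -> R^o) x).
    by have [/(_ x) dp _] := spsi 1; apply: DeriveDef => //; exact: diff_derivable.
  have dpsi0 x : ~ K x -> 'D_(e_ i) (psi : _ -> R^o) x = 0.
    move=> Kx; apply: (is_derive_eq0_near (dpsi x)).
    have KC : open (~` K).
      by rewrite openC; apply: compact_closed => //; exact: norm_hausdorff.
    by apply: filterS (open_nbhs_nbhs (conj KC Kx)) => y; exact: psi0.
  have := @Rintegral_by_parts_supp _ _ i M (v ^~ s) (fun y => gu y s ord0 i) psi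
    (fun x => 'D_(e_ i) (psi : _ -> R^o) x) cv (cg i) (spsi 0).
  move=> /(_ ((spsi 1).2 (e_ i)) (gaussian_is_derive Lambda N_gt0 normH sconvH i ^~ s) dpsi).
  move=> /(_ (fun x Mx => psi0 x (KM x Mx)) (fun x Mx => dpsi0 x (KM x Mx))).
  have toD (f : 'rV[R]_N -> R) : (forall y, ~ K y -> f y = 0) ->
      \int[leb]_(y in dual_ball H 0 r) f y = \int[leb]_y f y.
    move=> f0; rewrite Rintegral_mkcond; apply: eq_Rintegral => y _; rewrite patchE.
    by case: ifPn => //; rewrite notin_setE => Dy; rewrite f0// => /KD.
  rewrite -toD => [|y Ky]; last by rewrite dpsi0// mulr0.
  rewrite -toD => [<-|y Ky]; last by rewrite psi0// mulr0.
  by apply: eq_Rintegral => y _; rewrite mxE.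
Qed.

Lemma gaussian_cvg_L1 r t : t < T ->
  (\int[leb]_(y in dual_ball H 0 r) `|v y s - v y t|%:E)%E @[s --> t] --> 0%E.
Proof.
move=> tT; have [M DM] := dual_ball_bounded r; have mD := measurable_dual_ball 0 r.
apply: (cvg_L1_dist (f := fun z => v z.1 z.2) mD DM).
  by move=> y; exact: gaussian_continuous.
by move=> s; apply: measurable_funTS; apply: continuous_measurable_rV;
  exact: (@gaussian_continuous_x _ _ _ Lambda N_gt0 normH s).
Qed.

Lemma gaussian_grad_cvg_L1 r i t : t < T ->
  (\int[leb]_(y in dual_ball H 0 r) `|gu y s ord0 i - gu y t ord0 i|%:E)%E
    @[s --> t] --> 0%E.
Proof.
move=> tT; have [M DM] := dual_ball_bounded r; have mD := measurable_dual_ball 0 r.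
apply: (cvg_L1_dist (f := fun z => gu z.1 z.2 ord0 i) mD DM).
  by move=> y; exact: gaussian_grad_continuous.
by move=> s; apply: measurable_funTS; apply: continuous_measurable_rV;
  exact: (@gaussian_grad_continuous_x _ _ _ Lambda N_gt0 normH sconvH s i).
Qed.

Lemma gaussian_W11norm_cvg r t : t < T ->
  W11norm (dual_ball H 0 r)
    ((v ^~ s, gu ^~ s) - (v ^~ t, gu ^~ t)) @[s --> t] --> 0%E.
Proof.
move=> tT; rewrite /W11norm /=.
have sum0 : (\sum_(i < N) \int[leb]_(y in dual_ball H 0 r)
    `|((gu y s - gu y t : 'rV[R]_N)) ord0 i|%:E)%E @[s --> t] --> (\sum_(i < N) 0%E)%E.
  have PF : ProperFilter (nbhs t) by exact: nbhs_pfilter.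
  apply: cvg_nnesum => i _.
    by apply: nearW => s; apply: integral_ge0 => y _; rewrite lee_fin.
  have := @gaussian_grad_cvg_L1 r i t tT.
  apply: cvg_trans; apply: near_eq_cvg; apply: nearW => s.
  by apply: eq_integral => y _; rewrite !mxE.
rewrite big1 // in sum0.
rewrite -[X in _ --> X]adde0; apply: cvgeD => //; exact: gaussian_cvg_L1.
Qed.

Lemma gaussian_W11norm_bounded r S : S < T ->
  exists C : R, forall t, 0 < t < S ->
    (0 <= W11norm (dual_ball H 0 r) (v ^~ t, gu ^~ t) <= C%:E)%E.
Proof.
move=> ST; have [M DM] := dual_ball_bounded r; have mD := measurable_dual_ball 0 r.
(* A closed cylinder ending at S < T: v and its gradient are continuous on it, hence bounded
   uniformly in time. *)
pose K := [set y : 'rV[R]_N | `|y| <= M] `*` `[0, S]%classic.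
have cK : compact K.
  exact: (compact_setX (@compact_closed_box _ _ M) (@segment_compact _ 0 S)).
have KT z : K z -> z.2 < T.
  by move=> [_ /=]; rewrite in_itv/= => /andP[_ zS]; exact: le_lt_trans ST.
have [C C0 vC] := @bounded_on_compact _ _ K (fun z => v z.1 z.2) cK
  (fun z Kz => ltac:(case: z Kz => y s Kz; exact: gaussian_continuous (KT _ Kz))).
have /choice [B BP] : forall i, exists B : R, forall z, K z -> `|gu z.1 z.2 ord0 i| <= B.
  move=> i; have [|B _ HB] := @bounded_on_compact _ _ K (fun z => gu z.1 z.2 ord0 i) cK.
    by move=> [y s] Kz; exact: gaussian_grad_continuous (KT _ Kz).
  by exists B.
have Dfin := lebesgue_bounded_fin mD DM.
have Dnum : leb (dual_ball H 0 r) \is a fin_num by rewrite ge0_fin_numE.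
have bound (f : 'rV[R]_N -> R) (c : R) : (forall y, dual_ball H 0 r y -> `|f y| <= c) ->
    (\int[leb]_(y in dual_ball H 0 r) `|f y|%:E <= (c * fine (leb (dual_ball H 0 r)))%:E)%E.
  move=> fc; apply: (@le_trans _ _ (\int[leb]_(y in dual_ball H 0 r) c%:E)%E).
    by apply: le_integral_nonneg => y /fc; rewrite !lee_fin normr_ge0.
  by rewrite integral_cst// EFinM fineK.
exists (C * fine (leb (dual_ball H 0 r)) +
  \sum_(i < N) B i * fine (leb (dual_ball H 0 r))) => t /andP[t0 tS].
have Kt y : dual_ball H 0 r y -> K (y, t).
  by move=> /DM yM; split => //=; rewrite in_itv/= !ltW.
rewrite /W11norm /=; apply/andP; split.
  apply: adde_ge0; first by apply: integral_ge0 => y _; rewrite lee_fin.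
  by apply: sume_ge0 => i _; apply: integral_ge0 => y _; rewrite lee_fin.
rewrite EFinD -sumEFin; apply: leeD; first by apply: bound => y /Kt/vC.
by apply: lee_sum => i _; apply: bound => y /Kt/BP.
Qed.

Lemma locally_integrable_gaussian : locally_integrable_rV (v ^~ 0).
Proof.
have cv := @gaussian_continuous_x _ _ _ Lambda N_gt0 normH 0.
split; first exact: continuous_measurable_rV.
move=> K cK; have [M [_ /(_ (`|M| + 1))]] := compact_bounded cK => KM.
have {}KM y : K y -> `|y| <= `|M| + 1.
  by apply: KM; rewrite (le_lt_trans (ler_norm _))// ltrDl.
have /integrableP[_] := continuous_integrable_bounded (compact_measurable_rV cK) KM cv.
by [].
Qed.

Lemma gaussian_is_solution :
  is_solution H T (radon_of_density locally_integrable_gaussian) v.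
Proof.
split; first exact: measurable_gaussian.
exists gu; split.
- move=> r r0; split; first by move=> t _; have [] := gaussian_W11 r t.
  move=> t; rewrite /= in_itv/= => /andP[_ tT].
  by apply: cvg_within_filter; exact: gaussian_cvg_L1.
- move=> r e r0 /andP[e0 eT].
  have ST : T - e < T by rewrite gtrBl.
  have [C CP] := @gaussian_W11norm_bounded r _ ST.
  apply: (@bochner_L1_continuous _ _ _ _ _ _ C).
  + by move=> t; exact: gaussian_W11.
  + by move=> t /andP[_ tS]; apply: gaussian_W11norm_cvg; exact: lt_trans ST.
  + exact: CP.
- move=> t phi t0T [sphi [K [cK KT] phi0]].
  (* The support projects to a bounded set of space, with one radius [M] for all times. *)
  have [|M _ KM'] := @bounded_on_compact _ _ K (fun z : 'rV[R]_N * R => `|z.1|) cK.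
    move=> z _; have FF : Filter (nbhs z) := nbhs_filter z.
    by apply: cvg_norm; exact: cvg_fst.
  have KM z : K z -> `|z.1| <= M by move=> /KM'; rewrite normr_id.
  have phiM y s : 0 <= s < T -> M < `|y| -> phi (y, s) = 0.
    by move=> sT My; apply: phi0 => // /KM /=; rewrite leNgt My.
  rewrite (gaussian_weak_identity N_gt0 normH sconvH Lambda_gt0 sphi phiM t0T).
  rewrite radon_integral_density//.
    by move=> x; exact: gaussian_ge0.
  apply: continuous_measurable_rV => y.
  by apply: continuous_slice1; exact: smooth_continuous.
Qed.

(** The density exp(Lambda H0^2) is positive, so it is also the density of the variation, and the
    weight cancels it exactly. What remains is the volume of a dual ball, contained in a cube of
    half-side C r centred at x, whatever x is. *)
Lemma gaussian_weighted_mass :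
  (ereal_sup [set \int[radon_variation (radon_of_density locally_integrable_gaussian)]_(y in
    dual_ball H x (Num.sqrt Lambda)^-1) (expR (- Lambda * H0 y ^+ 2))%:E
      | x in [set: 'rV[R]_N]] < +oo)%E.
Proof.
set r := (Num.sqrt Lambda)^-1.
have r0 : 0 <= r by rewrite invr_ge0 sqrtr_ge0.
have [C C0 HC] := norm_le_dual N_gt0 normH.
apply: (@le_lt_trans _ _ ((2 * (C * r)) ^+ N)%:E); last exact: ltry.
apply: ge_ereal_sup => _ [x _ <-].
have mD := measurable_dual_ball x r.
have mexp : measurable_fun (dual_ball H x r) (fun y => expR (- Lambda * H0 y ^+ 2)).
  apply: measurable_funTS; apply: continuous_measurable_rV => y.
  have FF : Filter (nbhs y) := nbhs_filter y.
  apply: (@cvg_comp _ _ _ _ expR _ (nbhs (- Lambda * H0 y ^+ 2)));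
    last exact: continuous_expR.
  by apply: cvgM; [exact: cvg_cst|apply: cvgM; exact: dual_norm_continuous].
rewrite (integral_radon_variation_density _ _ mD mexp)//; last first.
  by move=> y; exact: gaussian_ge0.
rewrite (eq_integral (fun=> 1%E)) => [|y _]; last first.
  rewrite /gaussian mulr0 subr0 powR1 mul1r divr1 -expRD mulNr addNr.
  by rewrite expR0.
rewrite integral_cst// mul1e.
apply: (le_trans _ (lebesgue_closed_box_le x (mulr_ge0 (ltW C0) r0))).
apply: le_measure; rewrite ?inE//.
  apply: measurable_le_continuous_rV => y; have FF : Filter (nbhs y) := nbhs_filter y.
  by apply: cvg_norm; apply: cvgB; [exact: cvg_id|exact: cvg_cst].
move=> y /= yr; apply: (le_trans (HC _)); rewrite ler_wpM2l ?ltW//.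
Qed.

End solution.

Theorem theorem1p3 (R : realType) (N : nat) (H : 'rV[R]_N -> R) (Lambda : R)
    (N_ge1 : (1 <= N)%N) (normH : finsler_norm H)
    (sconvH : strictly_convex_set [set xi | H xi < 1])
    (Lambda_gt0 : 0 < Lambda) :
  let H0 := dual_norm H in
  let S_Lambda := (4 * Lambda)^-1 in
  let v (x : 'rV[R]_N) (t : R) : R :=
    (1 - 4 * Lambda * t) `^ (- (N%:R / 2)) *
    expR (Lambda * H0 x ^+ 2 / (1 - 4 * Lambda * t)) in
  (exists hv : locally_integrable_rV (v ^~ 0),
    let mu := radon_of_density hv in
    is_solution H S_Lambda mu v /\
    (ereal_sup [set \int[radon_variation mu]_(y in
        dual_ball H x (Num.sqrt Lambda)^-1) (expR (- Lambda * H0 y ^+ 2))%:E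
      | x in [set: 'rV[R]_N]] < +oo)%E) /\
  (forall t, 0 <= t < S_Lambda -> forall x, v 0 t <= v x t) /\
  v 0 t @[t --> S_Lambda^'-] --> +oo.
Proof.
move=> H0 T v; split; [|split].
- exists (locally_integrable_gaussian Lambda N_ge1 normH); split.
    exact: gaussian_is_solution.
  exact: gaussian_weighted_mass.
- by move=> t /andP[_ tT] x; exact: gaussian_min.
- exact: gaussian_blowup.
Qed.
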